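(* Let $\mathbb F$ be any field. (a) Let $\mathcal A$ and $\mathcal B$ be two linear operators on a finite dimensional vector space over $\mathbb F$ such that $\mathcal A\mathcal B=\mathcal B\mathcal A=0$. Then $(\mathcal A,\mathcal B)$ is isomorphic to a direct sum of pairs of path type and pairs of cycle type, and this sum is uniquely determined by $(\mathcal A,\mathcal B)$, up to (i) permutation of direct summands, and (ii) replacing any summand of cycle type, given by a cycle graph on vertices $1,\dots,t$ (with its associated Frobenius block $\Phi$), with the pair given by any cycle graph obtained from it by a cyclic renumbering of its vertices $(1,2,\dots,t)\to(i,i+1,\dots,t,1,\dots,i-1)$ and/or, if there are at least two double arrows, by transferring $\Phi$ (associated with one double arrow) to another double arrow. (b) Each pair $(A,B)$ of square matrices of the same size over $\mathbb F$ with $AB=BA=0$ is similar to a direct sum of matrix pairs of path type and matrix pairs of cycle type, and this sum is uniquely determined by $(A,B)$, up to the transformations (i) and (ii) above (applied to the matrix pairs given by the corresponding graphs).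
   Context: All vector spaces are finite dimensional over the field $\mathbb F$, and all matrices have entries in $\mathbb F$. Isomorphism, direct sum, similarity. For pairs of linear operators $(\mathcal A,\mathcal B)$ on $V$ and $(\mathcal A',\mathcal B')$ on $V'$, the direct sum is $(\mathcal A\oplus\mathcal A',\mathcal B\oplus\mathcal B')$ on $V\oplus V'$. The pairs are isomorphic if there is a linear bijection $\varphi:V\to V'$ with $\varphi\mathcal A=\mathcal A'\varphi$ and $\varphi\mathcal B=\mathcal B'\varphi$. Two pairs $(A,B)$, $(A',B')$ of $n\times n$ matrices are similar if $(A',B')=(S^{-1}AS,S^{-1}BS)$ for some nonsingular $S$; the direct sum of matrix pairs is $(A,B)\oplus(A',B')=(A\oplus A',B\oplus B')$ (block diagonal). Frobenius block. A Frobenius block is an $n\times n$ matrix ($n\ge1$) $$\begin{bmatrix}0&&0&-c_n\\1&\ddots&&\vdots\\&\ddots&0&-c_2\\0&&1&-c_1\end{bmatrix}$$ (the companion matrix) for which $x^n+c_1x^{n-1}+\dots+c_n=p(x)^l$ is a positive integer power of a polynomial $p(x)$ irreducible over $\mathbb F$. (If $\mathbb F$ is algebraically closed, one may use Jordan blocks instead of Frobenius blocks throughout.) Arrows. Ordinary arrows $\longrightarrow$ represent the action of $\mathcal A$; double arrows $\Longrightarrow$ represent the action of $\mathcal B$. Path type. Let $t\ge1$ and take a path graph on $1,2,\dots,t$ in which, for each $i=1,\dots,t-1$, the edge between $i$ and $i+1$ is either an ordinary arrow $i\longrightarrow i+1$ or a double arrow $i\Longleftarrow i+1$. Let $V=\mathbb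 Fe_1\oplus\dots\oplus\mathbb Fe_t$ and put $\mathcal Ae_i=e_{i+1}$ if $i\longrightarrow i+1$, $\mathcal Be_{i+1}=e_i$ if $i\Longleftarrow i+1$, all unspecified actions being zero. The resulting pair $(\mathcal A,\mathcal B)$ is called a pair of path type, and its matrix pair $(A,B)$ in the basis $e_1,\dots,e_t$ is called a matrix pair of path type. (Thus $A$ has entry $1$ at $(i+1,i)$ if $i\longrightarrow i+1$, $B$ has entry $1$ at $(i,i+1)$ if $i\Longleftarrow i+1$, and all other entries are zero.) Cycle type. Let $t\ge1$ and take a cycle graph on $1,2,\dots,t$ in which, for each $i=1,\dots,t$ (with $t+1$ read as $1$), the edge between $i$ and $i+1$ is either an ordinary arrow $i\longrightarrow i+1$ or a double arrow $i\Longleftarrow i+1$; for $t=1$ this is a loop that is ordinary or double. Assume the graph is aperiodic: for each $i=2,\dots,t$ the cyclic renumbering $(1,2,\dots,t)\to(i,i+1,\dots,i-1)$ is not an isomorphism of the graph, i.e. each nontrivial rotation maps some ordinary arrow to a double arrow or some double arrow to an ordinary arrow. (Hence if the graph has no double arrow, then it is an ordinary loop with $t=1$.) Let $\Phi$ be a nonsingular Frobenius block, of size $k\times k$. If the graph has no double arrow, associate $\Phi$ with the arrow of the loop; if the graph has a double arrow, choose any double arrow and associate $\Phi$ with it. Let $V=V_1\oplus\dots\oplus V_t$ with $V_i=\mathbb Fe_{i1}\oplus\dots\oplus\mathbb Fe_{ik}$. Each ordinary arrow $i\longrightarrow i+1$ gives the restriction of $\mathcal A$ to a map $V_i\to V_{i+1}$,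 and each double arrow $i\Longleftarrow i+1$ gives the restriction of $\mathcal B$ to a map $V_{i+1}\to V_i$; in the given bases this map has matrix $\Phi$ if the arrow is associated with $\Phi$, and the identity matrix $I_k$ otherwise; all unspecified actions are zero. The resulting pair $(\mathcal A,\mathcal B)$ is called a pair of cycle type, and its matrix pair in the basis $e_{11},\dots,e_{1k};\dots;e_{t1},\dots,e_{tk}$ is called a matrix pair of cycle type. (For $t=1$ this is $(\Phi,0_k)$ for an ordinary loop and $(0_k,\Phi)$ for a double loop.) *)

(* Defs.v *)
From HB Require Import structures.
From Stdlib Require Import Permutation.
From mathcomp Require Import all_boot all_order all_algebra.

Set Implicit Arguments.
Unset Strict Implicit.
Unset Printing Implicit Defensive.

Import GRing.Theory.
Local Open Scope ring_scope.

(** Vertices and edges are numbered from 0, and the edge number [i] joins the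
    vertices [i] and [i+1]: it is [i --> i+1] if [Ordinary] and
    [i <== i+1] if [Double].  A path graph on [t] vertices is a list of [t-1]
    arrows; a cycle graph on [t] vertices is a list of [t] arrows, the last one
    joining the vertices [t-1] and [0]. *)
Inductive arrow := Ordinary | Double.

Definition double_at (w : seq arrow) (i : nat) : bool :=
  if nth Ordinary w i is Double then true else false.

Definition aperiodic (w : seq arrow) : Prop :=
  forall i, (0 < i < size w)%N -> rotr i w <> w.

Section Pairs.
Variable F : fieldType.

(** The entry condition is the one of the transpose of [companionmx (p ^+ l)];
    it forces [0 < k] because irreducible polynomials are not constant. *)
Definition frobenius_block k (Phi : 'M[F]_k) : Prop :=
  exists (p : {poly F}) (l : nat),
    [/\ irreducible_poly p, (0 < l)%N, p ^+ l \is monic,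
        size (p ^+ l) = k.+1 &
        Phi = \matrix_(i, j) if j.+1 == k then - (p ^+ l)`_i
                             else (i == j.+1 :> nat)%:R].

(** Matrices act on column vectors. *)
Record mxpair := MxPair {
  mxsize : nat;
  mxA : 'M[F]_mxsize;
  mxB : 'M[F]_mxsize
}.

Definition mxdsum (P Q : mxpair) : mxpair :=
  MxPair (block_mx (mxA P) 0 0 (mxA Q)) (block_mx (mxB P) 0 0 (mxB Q)).

Definition mxpair0 : mxpair := @MxPair 0 0 0.

Inductive mxsimilar : mxpair -> mxpair -> Prop :=
  MxSimilar n (A B S : 'M[F]_n) of S \in unitmx :
    mxsimilar (MxPair A B)
              (MxPair (invmx S *m A *m S) (invmx S *m B *m S)).

Record oppair := OpPair {
  opspace : vectType F;
  opA : 'End(opspace);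
  opB : 'End(opspace)
}.

Definition prod_fun (V W : vectType F) (f : 'End(V)) (g : 'End(W))
  (x : V * W) : V * W := (f x.1, g x.2).

Fact prod_fun_is_linear (V W : vectType F) (f : 'End(V)) (g : 'End(W)) :
  linear (prod_fun f g).
Proof. by move=> a x y; rewrite /prod_fun /= !linearP. Qed.

HB.instance Definition _ (V W : vectType F) (f : 'End(V)) (g : 'End(W)) :=
  GRing.isLinear.Build F (V * W)%type (V * W)%type *:%R (prod_fun f g)
    (prod_fun_is_linear f g).

Definition opdsum (P Q : oppair) : oppair :=
  OpPair (linfun (prod_fun (opA P) (opA Q)))
         (linfun (prod_fun (opB P) (opB Q))).

Definition opisomorphic (P Q : oppair) : Prop :=
  exists phi : 'Hom(opspace P, opspace Q),
    [/\ bijective phi,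
        (phi \o opA P)%VF = (opA Q \o phi)%VF &
        (phi \o opB P)%VF = (opB Q \o phi)%VF].

(** The space is ['cV_n], with basis [e_i = delta_mx i 0]. *)
Definition oppair_of_mx (P : mxpair) : oppair :=
  @OpPair 'cV[F]_(mxsize P) (linfun (mulmx (mxA P))) (linfun (mulmx (mxB P))).

Definition oppair0 : oppair := oppair_of_mx mxpair0.

Definition path_mxpair (w : seq arrow) : mxpair :=
  @MxPair (size w).+1
    (\matrix_(i, j) ((i == j.+1 :> nat) && ~~ double_at w j)%:R)
    (\matrix_(i, j) ((j == i.+1 :> nat) && double_at w i)%:R).

(** [m] is the number of the arrow associated with [Phi]; [ordS] is the cyclic
    successor. *)
Definition cycle_mxpair (w : seq arrow) (m k : nat) (Phi : 'M[F]_k) : mxpair :=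
  let X (i : 'I_(size w)) : 'M[F]_k := if i == m :> nat then Phi else 1%:M in
  MxPair
    (\mxblock_(i < size w, j < size w)
       if (i == ordS j) && ~~ double_at w j then X j else 0)
    (\mxblock_(i < size w, j < size w)
       if (j == ordS i) && double_at w i then X i else 0).

Inductive summand :=
| Path (w : seq arrow)
| Cycle (w : seq arrow) (m k : nat) (Phi : 'M[F]_k).

Definition wf_summand (s : summand) : Prop :=
  match s with
  | Path _ => True
  | Cycle w m k Phi =>
      [/\ (m < size w)%N, aperiodic w,
          (exists i, double_at w i) -> double_at w m,
          frobenius_block Phi & Phi \in unitmx]
  end.

Definition mx_of_summand (s : summand) : mxpair :=
  match s with
  | Path w => path_mxpair w
  | Cycle w m k Phi => cycle_mxpair w m Phi
  end.

Definition op_of_summand (s : summand) : oppair :=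
  oppair_of_mx (mx_of_summand s).

Definition wf_sum (s : seq summand) : Prop := List.Forall wf_summand s.

Definition mxsum (s : seq summand) : mxpair :=
  foldr mxdsum mxpair0 (map mx_of_summand s).

Definition opsum (s : seq summand) : oppair :=
  foldr opdsum oppair0 (map op_of_summand s).

(** In [Renumber], the vertex [v] gets the number [v + i] modulo the number of
    vertices, and [Phi] stays on the same (renumbered) arrow. *)
Inductive replacement : summand -> summand -> Prop :=
| Renumber w m k (Phi : 'M[F]_k) i of (i < size w)%N :
    replacement (Cycle w m Phi) (Cycle (rotr i w) ((m + i) %% size w) Phi)
| Transfer w m m' k (Phi : 'M[F]_k) of double_at w m & double_at w m' :
    replacement (Cycle w m Phi) (Cycle w m' Phi).

Inductive sum_equiv : seq summand -> seq summand -> Prop :=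
| EquivPermute s s' of Permutation s s' : sum_equiv s s'
| EquivReplace s1 x y s2 of replacement x y :
    sum_equiv (s1 ++ x :: s2) (s1 ++ y :: s2)
| EquivTrans s s' s'' of sum_equiv s s' & sum_equiv s' s'' : sum_equiv s s''.

Definition op_decomposition (P : oppair) (s : seq summand) : Prop :=
  wf_sum s /\ opisomorphic P (opsum s).

Definition mx_decomposition (P : mxpair) (s : seq summand) : Prop :=
  wf_sum s /\ mxsimilar P (mxsum s).

End Pairs.

(* Main.v *)
(** A homomorphism from a path or cycle to [(A, B)] is a chain of vectors
    linked by [A] and by the inverse relation of [B], a homomorphism to it is
    a chain of covectors.  If a covector at a vertex [i] pairs nontrivially
    with a vector at a vertex [j], then following both chains to the right
    shows that the word read from [i] is lexicographically at most the word
    read from [j].  Hence homomorphisms are triangular with respect to these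
    words.

    Uniqueness is Krull-Schmidt: by triangularity and aperiodicity an
    endomorphism of a summand is invertible as soon as its component at one
    vertex is, and for a Frobenius block the matrices commuting with it are
    invertible or nilpotent; so endomorphism rings are local, and a summand
    that splits off another one has the same words and the same block.

    Existence is by splitting off one summand.  If the left kernel of [B] is
    larger than the row space of [A], a pairing that is nonzero on the quotient
    can be extended arrow by arrow until it stops on both sides and gives a
    path; triangularity bounds its length by the dimension.  Otherwise
    pairings extend forever; by pigeonhole the lexicographically extreme word
    is periodic, extremality makes the relation of one period single-valued,
    hence an automorphism [T] of a subspace, and a Fitting type argument
    provides the complement.  A cyclic primary component of [T] is the
    Frobenius block. *)

Require Import Defs.
From HB Require Import structures.
From Stdlib Require Import Permutation Classical.
From mathcomp Require Import all_boot all_order all_algebra.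
From mathcomp Require Import zify.

Set Implicit Arguments.
Unset Strict Implicit.
Unset Printing Implicit Defensive.

Import GRing.Theory.
Local Open Scope ring_scope.

(** [B] is followed backwards, so one step along a word is a linear relation, not a map, and a chain
    alone does not certify a summand. What is extended is therefore a chain together with a cochain,
    with pairing 1 at every vertex. They give homomorphisms from and to the path or cycle; the
    composite is an endomorphism of the path or cycle with identity diagonal, triangular for the
    order of the words, hence invertible, and this splits the summand off. The same triangularity is
    the finiteness argument: [n.+1] vertices with distinct words and pairing 1 do not fit into
    dimension [n]. *)

Lemma unitmx_mul_eq0l (F : fieldType) m n (X : 'M[F]_m) (c : 'M_(m, n)) :
  X \in unitmx -> X *m c = 0 -> c = 0.
Proof. by move=> uX /(congr1 (mulmx (invmx X))); rewrite mulKmx // mulmx0. Qed.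

Lemma unitmx_mul_eq0r (F : fieldType) m n (X : 'M[F]_n) (c : 'M_(m, n)) :
  X \in unitmx -> c *m X = 0 -> c = 0.
Proof. by move=> uX /(congr1 (mulmx^~ (invmx X))); rewrite mulmxK // mul0mx.
Qed.

(** A word is a function [nat -> option arrow], [None] marking its end.  The
    letters are ordered by [Double < None < Ordinary]; [key l N i] encodes in
    base 3 the [N] letters of [l] from position [i], so that comparing keys is
    comparing these words lexicographically. *)
Definition letter_code (c : option arrow) : nat :=
  match c with Some Double => 0 | None => 1 | Some Ordinary => 2 end.

Fixpoint key (l : nat -> option arrow) (N i : nat) : nat :=
  match N with
  | 0 => 0
  | N'.+1 => letter_code (l i) * 3 ^ N' +
             (if l i is None then 0 else key l N' i.+1)
  end.

Lemma key_lt l N i : (key l N i < 3 ^ N)%N.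
Proof.
elim: N i => [|N IH] i //=; rewrite expnS.
have := IH i.+1; have : (0 < 3 ^ N)%N by rewrite expn_gt0.
by case: (l i) => [[]|] /=; lia.
Qed.

Lemma letter_code_inj : injective letter_code.
Proof. by move=> [[]|] [[]|]. Qed.

(** Base 3 digits are determined by the number. After a [None] the key records only zeros, so
    agreement is obtained up to the first [None], which is included. *)
Lemma key_eq l l' N i j : key l N i = key l' N j ->
  forall m, (m < N)%N -> (forall r, (r < m)%N -> l (i + r)%N <> None) ->
  l (i + m)%N = l' (j + m)%N.
Proof.
elim: N i j => [|N IH] i j //= E.
have p0 : (0 < 3 ^ N)%N by rewrite expn_gt0.
have [k1 k2] := (key_lt l N i.+1, key_lt l' N j.+1).
have El : l i = l' j.
  apply: letter_code_inj; move: E k1 k2 p0.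
  by case: (l i) => [[]|]; case: (l' j) => [[]|] /=; lia.
move=> [|m] ltm nN; first by rewrite !addn0.
have li : l i <> None by have := nN 0%N isT; rewrite addn0.
rewrite -!addSnnS; apply: IH => //; last first.
  by move=> r ltr; rewrite addSnnS; apply: nN.
by move: E li; rewrite El; case: (l' j) => [[]|] //= /eqP;
  rewrite eqn_add2l => /eqP.
Qed.

(** * Pairings of chains with cochains *)

Section Chains.
Variables (F : fieldType) (n : nat) (A B : 'M[F]_n).

(** The images of the vertices of a path or cycle under a homomorphism to
    [(A, B)] form a chain, and dually the coordinates of a homomorphism from
    [(A, B)] form a cochain; [X i] is the matrix carried by the arrow [i]. *)
Definition chain_at k l (X : nat -> 'M[F]_k) (v : nat -> 'M[F]_(n, k)) i :=
  match l i with
  | Some Ordinary => A *m v i = v i.+1 *m X i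
  | Some Double => B *m v i.+1 = v i *m X i
  | None => A *m v i = 0
  end.

Definition cochain_at k l (X : nat -> 'M[F]_k) (f : nat -> 'M[F]_(k, n)) i :=
  match l i with
  | Some Ordinary => f i.+1 *m A = X i *m f i
  | Some Double => f i *m B = X i *m f i.+1
  | None => f i *m B = 0
  end.

Hypotheses (AB0 : A *m B = 0).

(** The order of the letters is dictated by the products that vanish. A covector that is
    [f i.+1 *m A] up to a unit kills a vector [B *m v j.+1] because [A *m B = 0], and kills a vector
    with [A *m v j = 0]; a covector with [f i *m B = 0] kills [B *m v j.+1]. For equal letters the
    pairing passes to the next vertices. *)
Lemma key_le k k' l l' (X : nat -> 'M[F]_k) (Y : nat -> 'M[F]_k') f v N i j :
  (forall m, X m \in unitmx) -> (forall m, Y m \in unitmx) ->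
  (forall m, (m < N)%N -> cochain_at l X f (i + m)) ->
  (forall m, (m < N)%N -> chain_at l' Y v (j + m)) ->
  f i *m v j != 0 -> (key l N i <= key l' N j)%N.
Proof.
move=> uX uY; elim: N i j => [|N IH] i j //= hf hv nz.
have IH' : f i.+1 *m v j.+1 != 0 -> (key l N i.+1 <= key l' N j.+1)%N.
  apply: IH => m ltm; rewrite addSnnS; [exact: hf | exact: hv].
have := hf 0%N isT; have := hv 0%N isT; rewrite !addn0 /chain_at /cochain_at.
have [k1 k2] := (key_lt l N i.+1, key_lt l' N j.+1).
have z0 : f i *m v j = 0 -> False by move=> E; rewrite E eqxx in nz.
case: (l i) => [[]|]; case: (l' j) => [[]|] /= Ev Ef; rewrite ?leq_add2l;
  try lia.
- apply: IH'; apply/eqP => E; apply: z0; apply: (unitmx_mul_eq0l (uX i)).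
  by rewrite mulmxA -Ef -mulmxA Ev mulmxA E mul0mx.
- case: z0; apply: (unitmx_mul_eq0l (uX i)); apply: (unitmx_mul_eq0r (uY j)).
  by rewrite mulmxA -Ef -2!mulmxA -Ev [A *m _]mulmxA AB0 mul0mx mulmx0.
- case: z0; apply: (unitmx_mul_eq0l (uX i)).
  by rewrite mulmxA -Ef -mulmxA Ev mulmx0.
- apply: IH'; apply/eqP => E; apply: z0; apply: (unitmx_mul_eq0r (uY j)).
  by rewrite -mulmxA -Ev mulmxA Ef -mulmxA E mulmx0.
- case: z0; apply: (unitmx_mul_eq0r (uY j)).
  by rewrite -mulmxA -Ev mulmxA Ef mul0mx.
Qed.

(** The values at the two ends of an arrow are the same product, [f i.+1 *m A *m v i] for [Ordinary]
    and [f i *m B *m v i.+1] for [Double]. *)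
Lemma pairing_const k k' l (f : nat -> 'M[F]_(k, n)) (v : nat -> 'M[F]_(n,
  k')) t :
  (forall i, (i < t)%N -> l i <> None) ->
  (forall i, (i < t)%N -> cochain_at l (fun=> 1%:M) f i) ->
  (forall i, (i < t)%N -> chain_at l (fun=> 1%:M) v i) ->
  forall i, (i <= t)%N -> f i *m v i = f 0 *m v 0.
Proof.
move=> lN hf hv; elim=> [|i IH] lt //; rewrite -IH; last exact: ltnW.
have := hf i lt; have := hv i lt; have := lN i lt.
rewrite /chain_at /cochain_at; case: (l i) => [[]|] //= _;
  rewrite mulmx1 mul1mx.
  by move=> <- <-; rewrite mulmxA.
by move=> <- <-; rewrite mulmxA.
Qed.

End Chains.

(** The blocks [E' i *m c *m E j] form a triangular matrix for the order given by [h]; a row vector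
    killed by [c] loses its components [z *m E j] in increasing order of [h j]. *)
Lemma triangular_unitmx (F : fieldType) N k t (E : nat -> 'M[F]_(N, k))
    (E' : nat -> 'M[F]_(k, N)) (c : 'M[F]_N) (h : nat -> nat) :
  \sum_(i < t) E i *m E' i = 1%:M ->
  (forall i j, (i < t)%N -> (j < t)%N -> h i = h j -> i = j) ->
  (forall i j, (i < t)%N -> (j < t)%N ->
     E' i *m c *m E j != 0 -> (h i <= h j)%N) ->
  (forall i, (i < t)%N -> E' i *m c *m E i \in unitmx) ->
  c \in unitmx.
Proof.
move=> S1 hinj hle hu; rewrite -row_free_unit; apply: inj_row_free => z zc.
suff zE : forall m i, (h i < m)%N -> (i < t)%N -> z *m E i = 0.
  rewrite -[z]mulmx1 -S1 mulmx_sumr big1 // => i _.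
  by rewrite mulmxA (zE (h i).+1) // mul0mx.
elim=> // m IH j; rewrite ltnS leq_eqVlt => /orP[/eqP hj | /IH //] ltj.
apply: (unitmx_mul_eq0r (hu j ltj)).
have : z *m 1%:M *m c *m E j = 0 by rewrite mulmx1 zc mul0mx.
rewrite -S1 mulmx_sumr !mulmx_suml (bigD1 (Ordinal ltj)) //= big1 ?addr0 => [|i
  ij].
  by rewrite !mulmxA.
rewrite -!mulmxA (mulmxA (E' i)).
have [->|nz] := eqVneq (E' i *m c *m E j) 0; first by rewrite !mulmx0.
rewrite mulmxA IH ?mul0mx //; rewrite -hj ltn_neqAle hle // andbT.
by apply: contra ij => /eqP/hinj E0; apply/eqP/val_inj/E0.
Qed.

(** * Homomorphisms and direct sums of matrix pairs *)

Definition mxhom (F : fieldType) (P Q : mxpair F)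
    (a : 'M[F]_(mxsize Q, mxsize P)) : Prop :=
  a *m mxA P = mxA Q *m a /\ a *m mxB P = mxB Q *m a.
Arguments mxhom {F} P Q a.

Definition annihilating (F : fieldType) (P : mxpair F) : Prop :=
  mxA P *m mxB P = 0 /\ mxB P *m mxA P = 0.

Definition inverse_mx (F : fieldType) m n (a : 'M[F]_(m, n)) (b : 'M_(n, m)) :=
  a *m b = 1%:M /\ b *m a = 1%:M.

(** Rectangular mutually inverse matrices avoid casts between sizes whose equality is only provable;
    [isomorphic_similar] recovers [mxsimilar]. *)
Definition isomorphic (F : fieldType) (P Q : mxpair F) : Prop :=
  exists a b, [/\ mxhom P Q a, mxhom Q P b & inverse_mx a b].

Section Homomorphisms.
Variable F : fieldType.
Implicit Types P Q R : mxpair F.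

Lemma mxhom1 P : mxhom P P 1%:M.
Proof. by split; rewrite mulmx1 mul1mx. Qed.

Lemma mxhomM P Q R a b : mxhom P Q a -> mxhom Q R b -> mxhom P R (b *m a).
Proof.
by move=> [aA aB] [bA bB]; split; rewrite -mulmxA ?aA ?aB !mulmxA ?bA ?bB.
Qed.

Lemma mxhom_inv P Q a b : mxhom P Q a -> inverse_mx a b -> mxhom Q P b.
Proof.
move=> [aA aB] [ab ba]; split; rewrite -[LHS]mulmx1 -ab mulmxA -(mulmxA b).
  by rewrite -aA mulmxA ba mul1mx.
by rewrite -aB mulmxA ba mul1mx.
Qed.

Lemma inverse_mxM m n p (a : 'M[F]_(m, n)) (b : 'M_(n, m)) (c : 'M_(n, p)) d :
  inverse_mx a b -> inverse_mx c d -> inverse_mx (a *m c) (d *m b).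
Proof.
move=> [ab ba] [cd dc]; split.
  by rewrite mulmxA -(mulmxA a) cd mulmx1.
by rewrite mulmxA -(mulmxA d) ba mulmx1.
Qed.

Lemma isomorphic_refl P : isomorphic P P.
Proof.
by exists 1%:M, 1%:M; split; [exact: mxhom1..|split; rewrite mulmx1].
Qed.

Lemma isomorphic_sym P Q : isomorphic P Q -> isomorphic Q P.
Proof. by move=> [a [b [ha hb [ab ba]]]]; exists b, a. Qed.

Lemma isomorphic_trans P Q R :
  isomorphic P Q -> isomorphic Q R -> isomorphic P R.
Proof.
move=> [a [b [ha hb ab]]] [c [d [hc hd cd]]].
exists (c *m a), (b *m d); split; [exact: mxhomM ha hc|exact: mxhomM hd hb|].
exact: inverse_mxM.
Qed.

Lemma mulmx1_eq_size m n (a : 'M[F]_(m, n)) b : inverse_mx a b -> m = n.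
Proof.
by case=> ab ba; apply/eqP; rewrite eqn_leq (mulmx1_min ab) (mulmx1_min ba).
Qed.

Lemma mulmx1C_eq_size m n (a : 'M[F]_(m, n)) b :
  m = n -> a *m b = 1%:M -> b *m a = 1%:M.
Proof. by move=> e; case: n / e a b => a b; apply: mulmx1C. Qed.

Lemma isomorphic_similar P Q : isomorphic P Q -> mxsimilar P Q.
Proof.
case: P Q => [m A B] [n A' B'] [a [b [[/= aA aB] _ ab]]].
have e := mulmx1_eq_size ab; case: m / e A B a b aA aB ab => A B a b aA aB [ab
  ba].
have ub : b \in unitmx by case/mulmx1_unit: ab.
have ib : invmx b = a by rewrite -[a](mulmxK ub) ab mul1mx.
have -> : A' = invmx b *m A *m b by rewrite ib aA -mulmxA ab mulmx1.
have -> : B' = invmx b *m B *m b by rewrite ib aB -mulmxA ab mulmx1.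
by constructor.
Qed.

Lemma similar_isomorphic P Q : mxsimilar P Q -> isomorphic P Q.
Proof.
case=> n A B S uS; exists (invmx S), S.
have i : inverse_mx (invmx S) S by split; rewrite ?mulVmx ?mulmxV.
have h : mxhom (MxPair A B) (MxPair (invmx S *m A *m S) (invmx S *m B *m S))
  (invmx S).
  by split; rewrite /= mulmxK.
by split=> //; exact: (mxhom_inv h i).
Qed.

Lemma mxhom_dsum P P' Q Q' a a' : mxhom P Q a -> mxhom P' Q' a' ->
  mxhom (mxdsum P P') (mxdsum Q Q') (block_mx a 0 0 a').
Proof.
move=> [aA aB] [aA' aB']; split=> /=;
by rewrite !mulmx_block !mul0mx !mulmx0 !addr0 !add0r ?aA ?aB ?aA' ?aB'.
Qed.

Lemma isomorphic_dsum P P' Q Q' : isomorphic P Q -> isomorphic P' Q' ->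
  isomorphic (mxdsum P P') (mxdsum Q Q').
Proof.
move=> [a [b [ha hb [ab ba]]]] [c [d [hc hd [cd dc]]]].
exists (block_mx a 0 0 c), (block_mx b 0 0 d).
split; [exact: mxhom_dsum..|]; rewrite /inverse_mx !mulmx_block.
by rewrite !mul0mx !mulmx0 !addr0 !add0r ab ba cd dc -!scalar_mx_block.
Qed.

Lemma mxhom_col P Q R a b :
  mxhom P Q a -> mxhom P R b -> mxhom P (mxdsum Q R) (col_mx a b).
Proof.
by move=> [aA aB] [bA bB]; split;
   rewrite /= mul_col_mx mul_block_col ?aA ?aB ?bA ?bB !mul0mx addr0 add0r.
Qed.

Lemma mxhom_row P Q R a b :
  mxhom Q P a -> mxhom R P b -> mxhom (mxdsum Q R) P (row_mx a b).
Proof.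
by move=> [aA aB] [bA bB]; split;
   rewrite /= mul_mx_row mul_row_block ?aA ?aB ?bA ?bB !mulmx0 addr0 add0r.
Qed.

Lemma mxhom_usub P Q R a : mxhom P (mxdsum Q R) a -> mxhom P Q (usubmx a).
Proof.
rewrite -[a]vsubmxK => -[]; rewrite /= !mul_block_col !mul_col_mx.
rewrite !mul0mx !addr0 !add0r => /eq_col_mx[aA _] /eq_col_mx[aB _].
by rewrite !col_mxKu.
Qed.

Lemma mxhom_dsub P Q R a : mxhom P (mxdsum Q R) a -> mxhom P R (dsubmx a).
Proof.
rewrite -[a]vsubmxK => -[]; rewrite /= !mul_block_col !mul_col_mx.
rewrite !mul0mx !addr0 !add0r => /eq_col_mx[_ aA] /eq_col_mx[_ aB].
by rewrite !col_mxKd.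
Qed.

Lemma mxhom_lsub P Q R a : mxhom (mxdsum Q R) P a -> mxhom Q P (lsubmx a).
Proof.
rewrite -[a]hsubmxK => -[]; rewrite /= !mul_row_block !mul_mx_row.
rewrite !mulmx0 !addr0 !add0r => /eq_row_mx[aA _] /eq_row_mx[aB _].
by rewrite !row_mxKl.
Qed.

Lemma mxhom_rsub P Q R a : mxhom (mxdsum Q R) P a -> mxhom R P (rsubmx a).
Proof.
rewrite -[a]hsubmxK => -[]; rewrite /= !mul_row_block !mul_mx_row.
rewrite !mulmx0 !addr0 !add0r => /eq_row_mx[_ aA] /eq_row_mx[_ aB].
by rewrite !row_mxKr.
Qed.

Lemma mxhom0 P Q : mxhom P Q 0.
Proof. by split; rewrite mul0mx mulmx0. Qed.

Definition mxswapCA m n p : 'M[F]_(n + (m + p), m + (n + p)) :=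
  col_mx (row_mx 0 (row_mx 1%:M 0))
         (col_mx (row_mx 1%:M 0) (row_mx 0 (row_mx 0 1%:M))).

Lemma mul_swapCA_col m n p q (x : 'M[F]_(m, q)) (y : 'M_(n, q)) (z : 'M_(p,
  q)) :
  mxswapCA m n p *m col_mx x (col_mx y z) = col_mx y (col_mx x z).
Proof.
by rewrite !mul_col_mx !mul_row_col !mul0mx !mul1mx !addr0 !add0r.
Qed.

Lemma mxswapCAK m n p : mxswapCA m n p *m mxswapCA n m p = 1%:M.
Proof.
rewrite mul_swapCA_col scalar_mx_block /block_mx; congr col_mx.
rewrite [in RHS]scalar_mx_block [in RHS]/block_mx -[X in row_mx X (col_mx _
  _)]col_mx0.
by rewrite -block_mxEh.
Qed.

Lemma mxhom_swapCA P Q R :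
  mxhom (mxdsum P (mxdsum Q R)) (mxdsum Q (mxdsum P R)) (mxswapCA _ _ _).
Proof.
apply: mxhom_col; [|apply: mxhom_col]; apply: mxhom_row; rewrite ?row_mx0;
  do ?[exact: mxhom1|exact: mxhom0].
  by apply: mxhom_row; [exact: mxhom1|exact: mxhom0].
by apply: mxhom_row; [exact: mxhom0|exact: mxhom1].
Qed.

Lemma isomorphic_dsumCA P Q R :
  isomorphic (mxdsum P (mxdsum Q R)) (mxdsum Q (mxdsum P R)).
Proof.
exists (mxswapCA _ _ _), (mxswapCA _ _ _).
by split; [exact: mxhom_swapCA..|split; exact: mxswapCAK].
Qed.

End Homomorphisms.

(** * Frames: the vertex decomposition of a path or cycle *)

(** [E i] is the inclusion of the space at the vertex [i] and [E' i] the
    projection on it.  In a cycle vertices are counted modulo [t], in a path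
    the ones beyond [t] carry the zero space. *)
Record frame (F : fieldType) (P : mxpair F) (cyc : bool) (t k : nat)
    (l : nat -> option arrow) (X : nat -> 'M[F]_k)
    (E : nat -> 'M[F]_(mxsize P, k)) (E' : nat -> 'M[F]_(k, mxsize P)) : Prop :=
  Frame {
    frame_gt0 : (0 < t)%N;
    frame_unit : forall i, X i \in unitmx;
    frame_chain : forall i, chain_at (mxA P) (mxB P) l X E i;
    frame_cochain : forall i, cochain_at (mxA P) (mxB P) l X E' i;
    frame_sum : \sum_(i < t) E i *m E' i = 1%:M;
    frame_orth : forall i j, (i < t)%N -> (j < t)%N ->
      E' i *m E j = if i == j then 1%:M else 0;
    frame_letter : forall i, (i.+1 < t)%N -> l i <> None;
    frame_last : if cyc then l t.-1 <> None else l t.-1 = None;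
    frame_closed : if cyc then E t = E 0 else mxB P *m E 0 = 0;
    frame_coclosed : if cyc then E' t = E' 0 else E' 0 *m mxA P = 0
  }.

Lemma annihilating_mulA (F : fieldType) (P : mxpair F) m (v : 'M_(mxsize P,
  m)) :
  annihilating P -> mxA P *m (mxB P *m v) = 0.
Proof. by case=> AB _; rewrite mulmxA AB mul0mx. Qed.

Lemma annihilating_mulB (F : fieldType) (P : mxpair F) m (v : 'M_(mxsize P,
  m)) :
  annihilating P -> mxB P *m (mxA P *m v) = 0.
Proof. by case=> _ BA; rewrite mulmxA BA mul0mx. Qed.

Section FrameHom.
Variables (F : fieldType) (P : mxpair F) (cyc : bool) (t k : nat).
Variables (l : nat -> option arrow) (X : nat -> 'M[F]_k).
Variables (E : nat -> 'M[F]_(mxsize P, k)) (E' : nat -> 'M[F]_(k, mxsize P)).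
Hypothesis fP : frame cyc t l X E E'.

Lemma frame_eqr m (a b : 'M[F]_(m, mxsize P)) :
  (forall j, (j < t)%N -> a *m E j = b *m E j) -> a = b.
Proof.
move=> h; rewrite -[a]mulmx1 -[b]mulmx1 -(frame_sum fP) !mulmx_sumr.
by apply: eq_bigr => i _; rewrite !mulmxA h.
Qed.

(** A chain prescribes one operator per arrow. The annihilating condition forces the other one: [B]
    vanishes on the target of an ordinary arrow and [A] on the target of a double arrow. *)
Lemma frame_hom (Q : mxpair F) (v : nat -> 'M[F]_(mxsize Q, k)) :
  annihilating P -> annihilating Q ->
  (forall i, (i < t)%N -> chain_at (mxA Q) (mxB Q) l X v i) ->
  (if cyc then v t = v 0 else mxB Q *m v 0 = 0) ->
  let a := \sum_(i < t) v i *m E' i in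
  mxhom P Q a /\ forall i, (i < t)%N -> a *m E i = v i.
Proof.
move=> aP aQ hv cv a.
have aE i : (i < t)%N -> a *m E i = v i.
  move=> lti; rewrite /a mulmx_suml (bigD1 (Ordinal lti)) //= big1 ?addr0.
    by rewrite -mulmxA (frame_orth fP) // eqxx mulmx1.
  move=> j ji; rewrite -mulmxA (frame_orth fP) //.
  by rewrite -val_eqE /= in ji; rewrite (negPf ji) mulmx0.
have aES i : (i < t)%N -> l i <> None -> a *m E i.+1 = v i.+1.
  move=> lti li; have [lt|ge] := ltnP i.+1 t; first exact: aE.
  have et : i.+1 = t by apply/eqP; rewrite eqn_leq lti.
  have := frame_last fP; rewrite -et /= => hl.
  have := frame_closed fP; move: cv hl; rewrite -et.
  by case: (cyc) => // -> _ ->; rewrite aE // (frame_gt0 fP).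
have hB i : (i < t)%N -> l i <> None ->
    a *m mxB P *m E i.+1 = mxB Q *m v i.+1.
  move=> lti li; have := aES i lti li; have := hv i lti.
  have := frame_chain fP i; rewrite /chain_at.
  case el: (l i) => [[]|] // c1 c2 e; last by rewrite -mulmxA c1 mulmxA aE //
    c2.
  have -> : mxB Q *m v i.+1 = 0.
    apply: (unitmx_mul_eq0r (frame_unit fP i)).
    by rewrite -mulmxA -c2 annihilating_mulB.
  apply: (unitmx_mul_eq0r (frame_unit fP i)).
  by rewrite -!mulmxA -c1 annihilating_mulB // mulmx0.
split=> //; split; apply: frame_eqr => i lti.
  rewrite -[RHS]mulmxA aE //; have := aES i lti; have := hv i lti.
  have := frame_chain fP i; rewrite /chain_at -mulmxA.
  case el: (l i) => [[]|] c1 c2 e; last by rewrite c1 c2 mulmx0.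
    by rewrite c1 mulmxA e // c2.
  have -> : mxA Q *m v i = 0.
    apply: (unitmx_mul_eq0r (frame_unit fP i)).
    by rewrite -mulmxA -c2 annihilating_mulA.
  have -> : mxA P *m E i = 0.
    apply: (unitmx_mul_eq0r (frame_unit fP i)).
    by rewrite -mulmxA -c1 annihilating_mulA.
  by rewrite mulmx0.
(* The action of [B] at a vertex depends on the arrow to its left, so the vertex 0 is governed by
   the closing condition. *)
rewrite -[RHS]mulmxA aE //; case: i lti => [|i] lti; last first.
  by apply: hB; [exact: ltnW|exact: (frame_letter fP)].
have := frame_closed fP; have := frame_last fP; move: cv.
have et : t.-1.+1 = t by rewrite prednK // (frame_gt0 fP).
case: (cyc) => [cv cl <-|cv _ c0]; last by rewrite -mulmxA c0 cv mulmx0.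
by rewrite -cv -et; apply: hB => //; rewrite -et.
Qed.

End FrameHom.

(** Transposition exchanges the roles of [A] and [B] and turns cochains into
    chains. *)
Definition mxdual (F : fieldType) (P : mxpair F) : mxpair F :=
  MxPair (mxB P)^T (mxA P)^T.

Definition dual_letter (c : option arrow) : option arrow :=
  match c with
  | Some Ordinary => Some Double | Some Double => Some Ordinary | None => None
  end.

Lemma chain_at_tr (F : fieldType) n (A B : 'M[F]_n) k l X
    (f : nat -> 'M[F]_(k, n)) i :
  cochain_at A B l X f i <->
  chain_at B^T A^T (dual_letter \o l) (fun i => (X i)^T) (fun i => (f i)^T) i.
Proof.
rewrite /cochain_at /chain_at /=; case: (l i) => [[]|] /=; rewrite -!trmx_mul;
by split=> [->|h]; rewrite ?trmx0 //; apply: trmx_inj; rewrite h ?trmx0.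
Qed.

Lemma cochain_at_tr (F : fieldType) n (A B : 'M[F]_n) k l X
    (v : nat -> 'M[F]_(n, k)) i :
  chain_at A B l X v i <->
  cochain_at B^T A^T (dual_letter \o l) (fun i => (X i)^T) (fun i => (v i)^T) i.
Proof.
rewrite /cochain_at /chain_at /=; case: (l i) => [[]|] /=; rewrite -!trmx_mul;
by split=> [->|h]; rewrite ?trmx0 //; apply: trmx_inj; rewrite h ?trmx0.
Qed.

Lemma annihilating_dual (F : fieldType) (P : mxpair F) :
  annihilating P -> annihilating (mxdual P).
Proof. by case=> AB BA; split; rewrite /= -trmx_mul ?AB ?BA trmx0. Qed.

Lemma frame_dual (F : fieldType) (P : mxpair F) cyc t k l X
    (E : nat -> 'M[F]_(mxsize P, k)) E' : frame cyc t l X E E' ->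
  @frame F (mxdual P) cyc t k (dual_letter \o l) (fun i => (X i)^T)
    (fun i => (E' i)^T) (fun i => (E i)^T).
Proof.
case=> t0 uX cE cE' S O hl hL cl cl'; split=> //=.
- by move=> i; rewrite unitmx_tr.
- by move=> i; apply/chain_at_tr.
- by move=> i; apply/cochain_at_tr.
- rewrite -[RHS]trmx1 -S linear_sum /=.
  by apply: eq_bigr => i _; rewrite trmx_mul.
- by move=> i j li lj; rewrite -trmx_mul O // eq_sym; case: eqP;
  rewrite ?trmx1 ?trmx0.
- by move=> i /hl; case: (l i) => [[]|].
- by move: hL; case: (cyc); case: (l _) => [[]|].
- by move: cl'; case: (cyc) => [->|h] //; rewrite -trmx_mul h trmx0.
- by move: cl; case: (cyc) => [->|h] //; rewrite -trmx_mul h trmx0.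
Qed.

Lemma frame_cohom (F : fieldType) (P : mxpair F) cyc t k l X
    (E : nat -> 'M[F]_(mxsize P, k)) E' (fP : frame cyc t l X E E')
    (Q : mxpair F) (f : nat -> 'M[F]_(k, mxsize Q)) :
  annihilating P -> annihilating Q ->
  (forall i, (i < t)%N -> cochain_at (mxA Q) (mxB Q) l X f i) ->
  (if cyc then f t = f 0 else f 0 *m mxA Q = 0) ->
  let b := \sum_(i < t) E i *m f i in
  mxhom Q P b /\ forall i, (i < t)%N -> E' i *m b = f i.
Proof.
move=> aP aQ hf cf b.
have [] := @frame_hom _ _ _ _ _ _ _ _ _ (frame_dual fP) (mxdual Q)
  (fun i => (f i)^T) (annihilating_dual aP) (annihilating_dual aQ).
- by move=> i /hf /chain_at_tr.
- by move: cf; case: (cyc) => [->|h] //; rewrite /= -trmx_mul h trmx0.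
have -> : \sum_(i < t) (f i)^T *m (E i)^T = b^T.
  by rewrite linear_sum /=; apply: eq_bigr => i _; rewrite trmx_mul.
move=> [/= hB hA] hE; split=> [|i /hE].
  by split; apply: trmx_inj; rewrite !trmx_mul.
by rewrite -trmx_mul => /trmx_inj.
Qed.

Lemma mxhom_chain (F : fieldType) (P Q : mxpair F) k l X
    (v : nat -> 'M[F]_(mxsize P, k)) a i :
  mxhom P Q a -> chain_at (mxA P) (mxB P) l X v i ->
  chain_at (mxA Q) (mxB Q) l X (fun i => a *m v i) i.
Proof.
move=> [aA aB]; rewrite /chain_at; case: (l i) => [[]|] h;
by rewrite mulmxA -?aA -?aB -mulmxA h ?mulmx0 // mulmxA.
Qed.

(** * Frames of the path and cycle pairs *)

Definition path_letter (w : seq arrow) (i : nat) : option arrow :=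
  if (i < size w)%N then Some (nth Ordinary w i) else None.

Definition path_vec (F : fieldType) (w : seq arrow) (i : nat) : 'cV[F]_(size
  w).+1 :=
  \col_j (j == i :> nat)%:R.

Definition path_covec (F : fieldType) (w : seq arrow) (i : nat) : 'rV[F]_(size
  w).+1 :=
  \row_j (j == i :> nat)%:R.

Definition cycle_letter (w : seq arrow) (i : nat) : option arrow :=
  Some (nth Ordinary w (i %% size w)).

Definition cycle_weight (F : fieldType) (w : seq arrow) (m k : nat) (Phi :
  'M[F]_k)
    (i : nat) :=
  if (i %% size w)%N == m then Phi else 1%:M.

Definition cycle_vec (F : fieldType) (w : seq arrow) (k i : nat) :
    'M[F]_(\sum_(j < size w) k, k) :=
  \mxcol_(j < size w) (if j == (i %% size w)%N :> nat then 1%:M else 0 :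
    'M[F]_k).

Definition cycle_covec (F : fieldType) (w : seq arrow) (k i : nat) :
    'M[F]_(k, \sum_(j < size w) k) :=
  \mxrow_(j < size w) (if j == (i %% size w)%N :> nat then 1%:M else 0 :
    'M[F]_k).

Lemma double_at_nth w i :
  nth Ordinary w i = if double_at w i then Double else Ordinary.
Proof. by rewrite /double_at; case: nth. Qed.

Section SummandFrames.
Variable F : fieldType.

Lemma path_annihilating w : annihilating (path_mxpair F w).
Proof.
split; apply/matrixP => i j; rewrite !mxE /= big1 // => m _; rewrite !mxE.
  case: eqP => //= im; case: eqP => //= jm; rewrite ?mulr0 ?mul0r //.
  by case: (double_at w m); rewrite ?mul0r ?mulr0.
case: eqP => //= mi; case: eqP => //= mj; rewrite ?mulr0 ?mul0r //.
have -> : i = j :> nat by apply/eqP; rewrite -eqSS -mi -mj.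
by case: (double_at w j); rewrite ?mul0r ?mulr0.
Qed.

Lemma path_vec_delta w i (lti : (i < (size w).+1)%N) :
  path_vec F w i = delta_mx (Ordinal lti) 0.
Proof. by apply/matrixP => j z; rewrite !mxE ord1 eqxx andbT. Qed.

Lemma path_covec_delta w i (lti : (i < (size w).+1)%N) :
  path_covec F w i = delta_mx 0 (Ordinal lti).
Proof. by apply/matrixP => z j; rewrite !mxE ord1 eqxx. Qed.

Lemma path_vec0 w i : (size w < i)%N -> path_vec F w i = 0.
Proof.
by move=> lti; apply/matrixP => j z; rewrite !mxE; case: eqP => // e;
  have := ltn_ord j; lia.
Qed.

Lemma path_covec0 w i : (size w < i)%N -> path_covec F w i = 0.
Proof.
by move=> lti; apply/matrixP => z j; rewrite !mxE; case: eqP => // e;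
  have := ltn_ord j; lia.
Qed.

Lemma path_frame w :
  @frame F (path_mxpair F w) false (size w).+1 1 (path_letter w)
    (fun=> 1%:M) (path_vec F w) (path_covec F w).
Proof.
split=> //.
- by move=> i; rewrite unitmx1.
- move=> i; rewrite /chain_at /path_letter; case: ltnP => lti.
    rewrite double_at_nth; case e: (double_at w i).
      rewrite (@path_vec_delta w i.+1 lti) (@path_vec_delta w i (leqW lti))
        mulmx1 -colE.
      apply/matrixP => j z; rewrite !mxE ord1 eqxx andbT /= eqSS [RHS]/=.
      rewrite eq_sym -val_eqE /=; case: eqP => // ->; by rewrite e.
    rewrite (@path_vec_delta w i.+1 lti) (@path_vec_delta w i (leqW lti))
      mulmx1 -colE.
    apply/matrixP => j z; rewrite !mxE ord1 eqxx andbT /= e andbT.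
    by rewrite -val_eqE.
  (* The first index without a letter is the last vertex; beyond it the vectors are zero. *)
  have [->|ne] := eqVneq i (size w); last first.
    by rewrite path_vec0 ?mulmx0 // ltn_neqAle eq_sym ne.
  rewrite (path_vec_delta (ltnSn _)) -colE; apply/matrixP => j z;
    rewrite !mxE /=.
  by have := ltn_ord j; case: eqP => //= ->; rewrite ltnn.
- move=> i; rewrite /cochain_at /path_letter; case: ltnP => lti.
    rewrite double_at_nth; case e: (double_at w i).
      rewrite (@path_covec_delta w i.+1 lti) (@path_covec_delta w i (leqW lti))
        mul1mx -rowE.
      by apply/matrixP => z j; rewrite !mxE ord1 eqxx /= e andbT -val_eqE.
    rewrite (@path_covec_delta w i.+1 lti) (@path_covec_delta w i (leqW lti))
      mul1mx -rowE.
    apply/matrixP => z j; rewrite !mxE ord1 eqxx /= eqSS eq_sym -val_eqE /=.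
    by case: eqP => //= ->; rewrite e.
  have [->|ne] := eqVneq i (size w); last first.
    by rewrite path_covec0 ?mul0mx // ltn_neqAle eq_sym ne.
  rewrite (path_covec_delta (ltnSn _)) -rowE; apply/matrixP => z j;
    rewrite !mxE /=.
  by have := ltn_ord j; case: eqP => //= ->; rewrite ltnn.
- apply/matrixP => u v; rewrite summxE (bigD1 u) //= big1 ?addr0 => [|i iu].
    by rewrite !mxE big_ord1 !mxE eqxx mul1r eq_sym.
  by rewrite !mxE big_ord1 !mxE eq_sym -val_eqE /= in iu *;
    rewrite (negPf iu) mul0r.
- move=> i j lti ltj; rewrite (path_covec_delta lti) (path_vec_delta ltj).
  rewrite mul_delta_mx_cond -val_eqE /=; case: (i == j);
    rewrite ?mulr0n // mulr1n.
  by apply/matrixP => u v; rewrite !mxE !ord1.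
- by move=> i; rewrite ltnS /path_letter => ->.
- by rewrite /path_letter ltnn.
- rewrite (path_vec_delta (ltn0Sn _)) -colE.
  by apply/matrixP => j z; rewrite !mxE.
- rewrite (path_covec_delta (ltn0Sn _)) -rowE.
  by apply/matrixP => j z; rewrite !mxE.
Qed.

Section Cycle.
Variables (w : seq arrow) (m k : nat) (Phi : 'M[F]_k).
Hypotheses (w0 : (0 < size w)%N) (uPhi : Phi \in unitmx).
Let t := size w.
Local Notation P := (cycle_mxpair w m Phi).
Local Notation X := (cycle_weight w m Phi).

Lemma cycle_index_lt i : (i %% t < t)%N. Proof. by rewrite ltn_mod. Qed.
Local Notation idx i := (Ordinal (cycle_index_lt i)).

Lemma mul_block_cycle_vec (C : 'I_t -> 'I_t -> 'M[F]_k) i :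
  \mxblock_(a, b) C a b *m cycle_vec F w k i = \mxcol_a C a (idx i).
Proof.
rewrite mul_mxblock_mxrow; apply: eq_mxcol => a.
rewrite (bigD1 (idx i)) //= big1 ?addr0 ?eqxx ?mulmx1 // => b.
by rewrite -val_eqE /= => /negPf ->; rewrite mulmx0.
Qed.

Lemma mul_cycle_covec_block (C : 'I_t -> 'I_t -> 'M[F]_k) i :
  cycle_covec F w k i *m \mxblock_(a, b) C a b = \mxrow_b C (idx i) b.
Proof.
rewrite mul_mxrow_mxblock; apply: eq_mxrow => b.
rewrite (bigD1 (idx i)) //= big1 ?addr0 ?eqxx ?mul1mx // => a.
by rewrite -val_eqE /= => /negPf ->; rewrite mul0mx.
Qed.

Lemma mul_cycle_vec i (Y : 'M[F]_k) :
  cycle_vec F w k i *m Y = \mxcol_(j < t) (if j == idx i then Y else 0 :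
    'M[F]_k).
Proof.
rewrite mxcol_mul; apply: eq_mxcol => j; rewrite -val_eqE /=.
by case: (_ == _); rewrite ?mul1mx ?mul0mx.
Qed.

Lemma mul_cycle_covec i (Y : 'M[F]_k) :
  Y *m cycle_covec F w k i = \mxrow_(j < t) (if j == idx i then Y else 0 :
    'M[F]_k).
Proof.
rewrite mul_mxrow; apply: eq_mxrow => j; rewrite -val_eqE /=.
by case: (_ == _); rewrite ?mulmx1 ?mulmx0.
Qed.

Lemma idxS i : idx i.+1 = ordS (idx i).
Proof. by apply: val_inj; rewrite /= -[in RHS]addn1 modnDml addn1. Qed.

Lemma ordS_eq (a b : 'I_t) : (ordS a == ordS b) = (a == b).
Proof. by rewrite (inj_eq (bij_inj (ordS_bij _))). Qed.

Lemma cycle_annihilating : annihilating P.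
Proof.
split; rewrite /= mul_mxblock -[RHS]mxblock0; apply: eq_mxblock => a b;
  rewrite big1 // => c _.
  case: andP => [[_ nc]|_]; last by rewrite mul0mx.
  by case: andP => [[_ dc]|_]; [rewrite dc in nc|rewrite mulmx0].
case: andP => [[/eqP -> da]|_]; last by rewrite mul0mx.
case: andP => [[ab db]|_]; last by rewrite mulmx0.
by rewrite ordS_eq in ab; rewrite -(eqP ab) da in db.
Qed.

Lemma cycle_frame :
  @frame F P true t k (cycle_letter w) X (cycle_vec F w k) (cycle_covec F w k).
Proof.
split=> //.
- by move=> i; rewrite /cycle_weight; case: eqP; rewrite ?unitmx1.
- move=> i; rewrite /chain_at /cycle_letter double_at_nth.
  case e: (double_at w _).
    rewrite mul_block_cycle_vec mul_cycle_vec; apply: eq_mxcol => j.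
    rewrite idxS ordS_eq eq_sym; case: eqP => //= ->; by rewrite e.
  rewrite mul_block_cycle_vec mul_cycle_vec; apply: eq_mxcol => j.
  by rewrite idxS /= e andbT.
- move=> i; rewrite /cochain_at /cycle_letter double_at_nth.
  case e: (double_at w _).
    rewrite mul_cycle_covec_block mul_cycle_covec; apply: eq_mxrow => j.
    by rewrite idxS /= e andbT.
  rewrite mul_cycle_covec_block mul_cycle_covec; apply: eq_mxrow => j.
  rewrite idxS ordS_eq eq_sym; case: eqP => //= ->; by rewrite e.
(* The covector of a vertex is a block row of the identity. *)
- pose c (i : 'I_t) := submxcol (1%:M : 'M[F]_(\sum_(j < t) k)) i.
  have covE (i : 'I_t) : cycle_covec F w k i = c i.
    rewrite -[LHS]mulmx1 -[1%:M]submxcolK mul_mxrow_mxcol.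
    rewrite [LHS](bigD1 i) //= [X in _ + X]big1 ?addr0 => [|j ji].
      by rewrite modn_small // eqxx mul1mx.
    by rewrite modn_small // -val_eqE /= in ji *; rewrite (negPf ji) mul0mx.
  rewrite -[RHS]submxcolK -[RHS](@eq_mxcol _ _ _ _
    (fun i : 'I_t => \sum_(j < t) if i == j then c j else 0)); last first.
    by move=> i; rewrite -big_mkcond /= [LHS](big_pred1 i) // => j;
      rewrite /= eq_sym.
  rewrite mxcol_sum; apply: eq_bigr => j _; rewrite covE mxcol_mul.
  apply: eq_mxcol => i; rewrite modn_small // -val_eqE /=.
  by case: (_ == _); rewrite ?mul1mx ?mul0mx.
- move=> i j lti ltj; rewrite mul_mxrow_mxcol [LHS](bigD1 (Ordinal lti)) //= [X
  in _ + X]big1 ?addr0.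
    by rewrite !modn_small // eqxx mul1mx.
  move=> a; rewrite -val_eqE /= modn_small // => /negPf ->; by rewrite mul0mx.
- by rewrite /cycle_vec modnn mod0n.
- by rewrite /cycle_covec modnn mod0n.
Qed.

End Cycle.
End SummandFrames.

(** * Frobenius blocks *)

Section Frobenius.
Variable F : fieldType.

Lemma char_poly_trmx n (M : 'M[F]_n) : char_poly M^T = char_poly M.
Proof.
rewrite /char_poly -[in RHS]det_tr; congr (\det _).
by rewrite /char_poly_mx linearB /= tr_scalar_mx map_trmx.
Qed.

Lemma char_poly_frobenius k (Phi : 'M[F]_k) (q : {poly F}) :
  q \is monic -> size q = k.+1 ->
  Phi = \matrix_(i, j) (if j.+1 == k then - q`_i else (i == j.+1 :> nat)%:R) ->
  char_poly Phi = q.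
Proof.
move=> mq sq; have e : k = (size q).-1 by rewrite sq.
subst k; move=> ->; rewrite -[RHS]companionmxK // -char_poly_trmx.
congr char_poly; apply/matrixP => i j; rewrite !mxE.
have := ltn_ord i; case: (_.-1) i j => // d i j _.
by rewrite eqSS eq_sym (eq_sym (j : nat)).
Qed.

Lemma frobenius_block_gt0 k (Phi : 'M[F]_k) : frobenius_block Phi -> (0 < k)%N.
Proof.
case=> p [l [[p1 _] l0 _ s _]].
have -> : k = ((size p).-1 * l)%N by rewrite -size_exp s.
by rewrite muln_gt0 l0 andbT -ltnS prednK // ltnW.
Qed.

Lemma frobenius_block1 : frobenius_block (1%:M : 'M[F]_1).
Proof.
exists ('X - 1%:P), 1%N; rewrite expr1; split=> //.
- exact: irredp_XsubC.
- exact: monicXsubC.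
- by rewrite size_XsubC.
- apply/matrixP => i j; rewrite !mxE !ord1 /= coefB coefX coefC /= sub0r.
  by rewrite opprK.
Qed.

Section Block.
Variables (n : nat) (Phi : 'M[F]_n.+1).
Hypothesis fPhi : frobenius_block Phi.

Lemma frobenius_iter i : (i <= n)%N ->
  Phi ^+ i *m delta_mx 0 0 = delta_mx (inord i) 0 :> 'cV_n.+1.
Proof.
elim: i => [|i IH] lti.
  by rewrite expr0 mul1mx; congr delta_mx; apply/val_inj; rewrite /= inordK.
rewrite exprS -mulmxA IH; last exact: ltnW.
rewrite -colE; case: fPhi => p [l [_ _ _ _ ->]]; apply/matrixP => u v;
  rewrite !mxE.
rewrite inordK; last exact: ltnW.
rewrite eqSS (ltn_eqF lti) ord1 eqxx andbT -val_eqE /= inordK //.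
Qed.

(** The first basis vector is cyclic, so a matrix commuting with [Phi] is determined by its first
    column, and these entries are the coefficients of [g]. *)
Lemma frobenius_commute (c : 'M[F]_n.+1) :
  c *m Phi = Phi *m c -> exists g, c = horner_mx Phi g.
Proof.
move=> cP; pose e0 : 'cV[F]_n.+1 := delta_mx 0 0.
pose g := \poly_(i < n.+1) c (inord i) 0; exists g.
have comm i : c *m Phi ^+ i = Phi ^+ i *m c.
  elim: i => [|i IH]; first by rewrite expr0 mul1mx mulmx1.
  by rewrite exprS mulmxA cP -mulmxA IH mulmxA.
have gcomm i : horner_mx Phi g *m Phi ^+ i = Phi ^+ i *m horner_mx Phi g.
  by apply: (commrX i); apply: comm_horner_mx.
have cg : c *m e0 = horner_mx Phi g *m e0.
  rewrite /g poly_def rmorph_sum mulmx_suml /=.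
  rewrite -colE [LHS]matrix_sum_delta; apply: eq_bigr => i _.
  rewrite big_ord1 mxE horner_mxZ rmorphXn /= horner_mx_X -scalemxAl inord_val.
  by rewrite (frobenius_iter (leq_ord _)) inord_val.
apply/matrixP => i j; suff: col j c = col j (horner_mx Phi g).
  by move/matrixP/(_ i 0); rewrite !mxE.
have ej : delta_mx j 0 = Phi ^+ j *m e0.
  by rewrite (frobenius_iter (leq_ord _)) inord_val.
by rewrite !colE ej !mulmxA comm gcomm -!mulmxA cg.
Qed.

(** The commutant is a quotient of the polynomial ring in which [p ^+ l] is zero: [g] is nilpotent
    there if [p] divides it, and invertible by Bezout otherwise. *)
Lemma frobenius_dichotomy (c : 'M[F]_n.+1) :
  c *m Phi = Phi *m c -> c \in unitmx \/ exists N, c ^+ N = 0.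
Proof.
move=> /frobenius_commute[g cg].
case: fPhi => p [l [ip l0 mp sp eP]].
have q0 : horner_mx Phi (p ^+ l) = 0.
  by rewrite -(char_poly_frobenius mp sp eP) Cayley_Hamilton.
have [/dvdpP[h gh] | npg] := boolP (p %| g); [right|left].
  exists l; rewrite cg -rmorphXn gh exprMn mulrC /=.
  by rewrite rmorphM /= q0 mul0r.
have /(coprimep_expl l)/Bezout_eq1_coprimepP[[u v] /= uv] : coprimep p g.
  by rewrite irreducible_poly_coprime.
have := congr1 (horner_mx Phi) uv; rewrite rmorphD !rmorphM /= q0 mulr0 add0r
  -cg.
by rewrite rmorph1 => /mulmx1_unit[].
Qed.

Lemma frobenius_local_succ (c1 c2 : 'M[F]_n.+1) : c1 *m Phi = Phi *m c1 ->
  c1 + c2 = 1%:M -> c1 \in unitmx \/ c2 \in unitmx.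
Proof.
move=> /frobenius_dichotomy[u|[N cN]] c12; [by left|right].
have : (1 - c1) * (\sum_(i < N) c1 ^+ i) = 1.
  by rewrite -opprB mulNr -subrX1 cN sub0r opprK.
have -> : 1 - c1 = c2 by rewrite -[1]c12 addrC addrA addNr add0r.
by case/mulmx1_unit.
Qed.

End Block.

Lemma frobenius_local k (Phi c1 c2 : 'M[F]_k) : frobenius_block Phi ->
  c1 *m Phi = Phi *m c1 -> c1 + c2 = 1%:M -> c1 \in unitmx \/ c2 \in unitmx.
Proof.
move=> fP; have := frobenius_block_gt0 fP.
by case: k Phi c1 c2 fP => // n Phi c1 c2 fP _; apply: frobenius_local_succ.
Qed.

Lemma frobenius_inj k (Phi Psi : 'M[F]_k) : frobenius_block Phi ->
  frobenius_block Psi -> char_poly Phi = char_poly Psi -> Phi = Psi.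
Proof.
case=> p [l [_ _ mp sp eP]] [p' [l' [_ _ mp' sp' eP']]].
rewrite (char_poly_frobenius mp sp eP) (char_poly_frobenius mp' sp' eP') => E.
by rewrite eP eP' E.
Qed.

(** The idempotent [a *m b] commutes with [Psi], so it is 1 or nilpotent, hence 0, which
    [b *m a = 1%:M] excludes. Thus the blocks are similar, and equal by their characteristic
    polynomials. The sizes become equal only during the proof, whence [existT]. *)
Lemma frobenius_retract_eq k k' (Phi : 'M[F]_k) (Psi : 'M[F]_k') a b :
  frobenius_block Phi -> frobenius_block Psi ->
  a *m Phi = Psi *m a -> b *m Psi = Phi *m b -> b *m a = 1%:M ->
  existT (fun k => 'M[F]_k) k Phi = existT (fun k => 'M[F]_k) k' Psi.
Proof.
move=> fP fQ aP bP ba.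
have [k0 k0'] := (frobenius_block_gt0 fP, frobenius_block_gt0 fQ).
case: k' k0' Psi a b fQ aP bP ba => // k' _ Psi a b fQ aP bP ba.
have abab : (a *m b) *m (a *m b) = a *m b.
  by rewrite mulmxA -(mulmxA a) ba mulmx1.
have /(frobenius_dichotomy fQ) : a *m b *m Psi = Psi *m (a *m b).
  by rewrite -mulmxA bP mulmxA aP mulmxA.
case=> [u|[N abN]]; last first.
  have : b *m (a *m b) *m a = 1%:M by rewrite !mulmxA ba mul1mx ba.
  have -> : a *m b = 0.
    elim: N abN => [|[|N] IH]; rewrite ?expr1 //.
      by move=> /(congr1 (mulmx (a *m b))); rewrite mulmx1 mulmx0.
    by rewrite 2!exprS mulrA [X in X * _]abab -exprS.
  rewrite mulmx0 mul0mx => /(congr1 (fun M : 'M_k => M (Ordinal k0) (Ordinal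
    k0))).
  by rewrite !mxE eqxx /= => /eqP; rewrite eq_sym oner_eq0.
have ab1 : a *m b = 1%:M by rewrite -[LHS](mulKmx u) abab mulVmx.
have e := mulmx1_eq_size (conj ba ab1).
subst k.
congr existT; apply: frobenius_inj => //.
have ua : a \in unitmx by case/mulmx1_unit: ab1.
have ePsi : Psi = a *m Phi *m invmx a by rewrite aP mulmxK.
rewrite ePsi /char_poly.
have aa : map_mx polyC a *m map_mx polyC (invmx a) = 1%:M.
  by rewrite -map_mxM mulmxV // map_mx1.
have -> : char_poly_mx (a *m Phi *m invmx a) =
    map_mx polyC a *m char_poly_mx Phi *m map_mx polyC (invmx a).
  by rewrite /char_poly_mx mulmxBr mulmxBl !map_mxM scalar_mxC -(mulmxA 'X%:M)
    aa mulmx1.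
by rewrite !det_mulmx mulrAC -det_mulmx aa det1 mul1r.
Qed.

End Frobenius.

(** * Words and replacements *)

Lemma nth_rot_mod (T : Type) (x0 : T) (w : seq T) i r :
  (i < size w)%N -> (r < size w)%N ->
  nth x0 (rot i w) r = nth x0 w ((r + i) %% size w).
Proof.
move=> lti ltr; rewrite /rot nth_cat size_drop.
have [lt|ge] := ltnP r (size w - i).
  by rewrite nth_drop modn_small addnC //; lia.
rewrite nth_take; last by lia.
have -> : (r + i = r - (size w - i) + size w)%N by lia.
by rewrite modnDr modn_small //; lia.
Qed.

(** A shift preserving the repeated word is the rotation by [d %% size w], which must be trivial. *)
Lemma aperiodic_dvd w d : aperiodic w -> (0 < size w)%N ->
  (forall r, nth Ordinary w ((r + d) %% size w) = nth Ordinary w (r %% size w))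
    ->
  (size w %| d)%N.
Proof.
move=> aw w0 h; rewrite /dvdn; case: posnP => // d0.
have ltd : (d %% size w < size w)%N by rewrite ltn_mod.
case: (aw _ (introT andP (conj d0 ltd))).
rewrite -[RHS](rotK (d %% size w)); congr rotr; symmetry.
apply: (@eq_from_nth _ Ordinary); rewrite size_rot // => r ltr.
by rewrite nth_rot_mod // modnDmr h modn_small.
Qed.

(** Read from the later vertex, the word ends earlier; [N] exceeds [size w] so that the final [None]
    is seen. *)
Lemma key_path_inj w N i j : (size w < N)%N -> (i <= size w)%N ->
  (j <= size w)%N ->
  key (path_letter w) N i = key (path_letter w) N j -> i = j.
Proof.
have aux i' j' : (size w < N)%N -> (j' <= size w)%N -> (i' < j')%N ->
    key (path_letter w) N i' = key (path_letter w) N j' -> False.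
  move=> ltN lej ltij /key_eq kE.
  have : path_letter w (i' + (size w - j')) = path_letter w (j' + (size w -
    j')).
    by apply: kE => [|r ltr]; [lia|rewrite /path_letter ifT //; lia].
  rewrite /path_letter subnKC // ltnn ifT //; lia.
move=> ltN lei lej e; case: (ltngtP i j) => // lt; exfalso.
  exact: (aux i j).
exact: (aux j i).
Qed.

(** Up to [size w] letters lead from [i'] to the vertex 0 and [size w] more go round once, hence two
    turns. *)
Lemma key_cycle_inj w i j : aperiodic w -> (i < size w)%N -> (j < size w)%N ->
  key (cycle_letter w) (size w).*2 i = key (cycle_letter w) (size w).*2 j ->
  i = j.
Proof.
move=> aw; have aux i' j' : (j' < size w)%N -> (i' < j')%N ->
    key (cycle_letter w) (size w).*2 i' = key (cycle_letter w) (size w).*2 j' ->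
    False.
  move=> lej ltij /key_eq kE; have w0 : (0 < size w)%N by lia.
  suff : (size w %| j' - i')%N by move/dvdn_leq; lia.
  apply: aperiodic_dvd => // r; have ltr : (r %% size w < size w)%N by rewrite
    ltn_mod.
  have : cycle_letter w (i' + (r %% size w + (size w - i'))) =
      cycle_letter w (j' + (r %% size w + (size w - i'))).
    by apply: kE => //; lia.
  have -> : (i' + (r %% size w + (size w - i')) = r %% size w + size w)%N by
    lia.
  have -> : (j' + (r %% size w + (size w - i')) =
             r %% size w + (j' - i') + size w)%N by lia.
  by rewrite /cycle_letter !modnDr modn_mod modnDml => -[].
move=> lti ltj e; case: (ltngtP i j) => // lt; exfalso.
  exact: (aux i j).
exact: (aux j i).
Qed.

(** Each size is a period of the other word, so by aperiodicity the sizes divide each other. *)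
Lemma cycle_letter_eq w w' i : aperiodic w -> aperiodic w' ->
  (0 < size w)%N -> (i < size w')%N ->
  (forall r, cycle_letter w r = cycle_letter w' (i + r)) -> w' = rotr i w.
Proof.
move=> aw aw' w0 lti h.
have h1 r : nth Ordinary w (r %% size w) = nth Ordinary w' ((i + r) %% size w').
  by have [] := h r.
have ltw' : (0 < size w')%N by lia.
have d1 : (size w %| size w')%N.
  by apply: aperiodic_dvd => // r; rewrite !h1 addnA modnDr.
have d2 : (size w' %| size w)%N.
  apply: aperiodic_dvd => // r.
  (* The hypothesis reads [w'] from [i] on, so a position of [w'] is first moved forward by
     [size w' - i]. *)
  have e x : ((r + x) %% size w' = (i + (r + (size w' - i) + x)) %% size w')%N.
    have -> : (i + (r + (size w' - i) + x) = r + x + size w')%N by lia.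
    by rewrite modnDr.
  by rewrite -[r in RHS]addn0 !e -!h1 addn0 modnDr.
have e : size w' = size w by apply/eqP; rewrite eqn_dvd d2.
rewrite -[w'](rotK i); congr rotr; apply: (@eq_from_nth _ Ordinary).
  by rewrite size_rot.
move=> r; rewrite size_rot => ltr; rewrite nth_rot_mod // addnC -h1 modn_small
  //.
by rewrite -e.
Qed.

Lemma aperiodic_rotr w i : aperiodic w -> aperiodic (rotr i w).
Proof.
move=> aw j; rewrite size_rotr => hj e; apply: (aw j hj).
by apply: (can_inj (rotrK i)); rewrite -[RHS]e rotr_rotr.
Qed.

Lemma double_at_rotr w m i : (i < size w)%N -> (m < size w)%N ->
  double_at (rotr i w) ((m + i) %% size w) = double_at w m.
Proof.
move=> lti ltm; rewrite /double_at -[w in RHS](rotrK i).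
by rewrite nth_rot_mod ?size_rotr.
Qed.

Lemma cycle_letter_rotr w i j : (i < size w)%N ->
  cycle_letter (rotr i w) (j + i) = cycle_letter w j.
Proof.
move=> lti; have w0 : (0 < size w)%N by lia.
rewrite /cycle_letter -[w in RHS](rotrK i) size_rot.
by rewrite nth_rot_mod ?size_rotr ?ltn_mod ?modnDml.
Qed.

(** * Replacements give isomorphic pairs *)

Section Replacement.
Variable F : fieldType.

(** Dual families of chains and cochains make [b *m a] the identity; equality of sizes gives the
    other product. *)
Lemma frame_iso (P Q : mxpair F) cyc t k l X
    (E : nat -> 'M[F]_(mxsize P, k)) E' (v : nat -> 'M[F]_(mxsize Q, k)) f :
  frame cyc t l X E E' -> annihilating P -> annihilating Q ->
  mxsize P = mxsize Q ->
  (forall i, (i < t)%N -> chain_at (mxA Q) (mxB Q) l X v i) ->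
  (forall i, (i < t)%N -> cochain_at (mxA Q) (mxB Q) l X f i) ->
  (if cyc then v t = v 0 else mxB Q *m v 0 = 0) ->
  (if cyc then f t = f 0 else f 0 *m mxA Q = 0) ->
  (forall i j, (i < t)%N -> (j < t)%N -> f i *m v j = if i == j then 1%:M else
    0) ->
  isomorphic P Q.
Proof.
move=> fP aP aQ sPQ hv hf cv cf O.
have [ha aE] := frame_hom fP aP aQ hv cv; have [hb bE] := frame_cohom fP aP aQ
  hf cf.
set a := \sum_(i < t) _ in ha aE; set b := \sum_(i < t) _ in hb bE.
have ba : b *m a = 1%:M.
  apply: (frame_eqr fP) => j ltj; rewrite -mulmxA aE // mul1mx /b mulmx_suml.
  rewrite (bigD1 (Ordinal ltj)) //= -mulmxA O // eqxx mulmx1 big1 ?addr0 // =>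
    i ij.
  by rewrite -val_eqE /= in ij; rewrite -mulmxA O // (negPf ij) mulmx0.
exists a, b; split=> //; split=> //.
exact: mulmx1C_eq_size sPQ ba.
Qed.

Lemma cycle_size w m k (Phi : 'M[F]_k) :
  mxsize (cycle_mxpair w m Phi) = (size w * k)%N.
Proof. by rewrite /= sum_nat_const card_ord. Qed.

Lemma cycle_vec_mod w k i : cycle_vec F w k (i %% size w) = cycle_vec F w k i.
Proof. by rewrite /cycle_vec modn_mod. Qed.

Lemma cycle_covec_mod w k i : cycle_covec F w k (i %% size w) = cycle_covec F w
  k i.
Proof. by rewrite /cycle_covec modn_mod. Qed.

Lemma cycle_orth w k i j : (0 < size w)%N ->
  cycle_covec F w k i *m cycle_vec F w k j =
  if (i %% size w == j %% size w)%N then 1%:M else 0.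
Proof.
move=> w0; have fw := cycle_frame 0 w0 (unitmx1 F k).
by rewrite -cycle_vec_mod -cycle_covec_mod (frame_orth fw) ?ltn_mod.
Qed.

Lemma renumber_iso w m k (Phi : 'M[F]_k) i :
  (i < size w)%N -> (m < size w)%N -> Phi \in unitmx ->
  isomorphic (cycle_mxpair w m Phi)
             (cycle_mxpair (rotr i w) ((m + i) %% size w) Phi).
Proof.
move=> lti ltm uP; have w0 : (0 < size w)%N by lia.
have w0' : (0 < size (rotr i w))%N by rewrite size_rotr.
have fQ := cycle_frame ((m + i) %% size w) w0' uP.
have Xe j : cycle_weight (rotr i w) ((m + i) %% size w) Phi (j + i) =
  cycle_weight w m Phi j.
  rewrite /cycle_weight size_rotr eqn_modDr; congr (if _ then _ else _).
  by rewrite [in LHS](modn_small ltm).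
apply: (@frame_iso _ (cycle_mxpair (rotr i w) ((m + i) %% size w) Phi) _ _ _ _
  _ _ _
  (fun j => cycle_vec F (rotr i w) k (j + i))
  (fun j => cycle_covec F (rotr i w) k (j + i)) (cycle_frame m w0 uP)).
- exact: cycle_annihilating.
- exact: cycle_annihilating.
- by rewrite !cycle_size size_rotr.
- move=> j ltj; have := frame_chain fQ (j + i); rewrite /chain_at.
  by rewrite cycle_letter_rotr // Xe addSn.
- move=> j ltj; have := frame_cochain fQ (j + i); rewrite /cochain_at.
  by rewrite cycle_letter_rotr // Xe addSn.
- rewrite -[LHS]cycle_vec_mod -[RHS]cycle_vec_mod.
  by congr cycle_vec; rewrite size_rotr modnDl.
- rewrite -[LHS]cycle_covec_mod -[RHS]cycle_covec_mod.
  by congr cycle_covec; rewrite size_rotr modnDl.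
- move=> a b lta ltb; rewrite cycle_orth // size_rotr eqn_modDr !modn_small //.
Qed.

(** Rescale by [Phi] the vertices after [m] up to [m']. Arrows inside this range keep their identity
    weights, while the weight [Phi] appears at [m] and is absorbed at [m']; both arrows being
    double, they point the same way and the block is not inverted. *)
Lemma transfer_iso w m m' k (Phi : 'M[F]_k) : Phi \in unitmx ->
  double_at w m -> double_at w m' ->
  isomorphic (cycle_mxpair w m Phi) (cycle_mxpair w m' Phi).
Proof.
move=> uP; have dlt i : double_at w i -> (i < size w)%N.
  by rewrite /double_at; case: ltnP => // ?; rewrite nth_default.
wlog lt : m m' / (m < m')%N => [hw|] dm dm'.
  case: (ltngtP m m') => [lt|lt|->]; last exact: isomorphic_refl.
    exact: hw.
  by apply: isomorphic_sym; apply: hw.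
have ltm' := dlt _ dm'; have w0 : (0 < size w)%N by lia.
pose Y j : 'M[F]_k := if (m < j %% size w <= m')%N then Phi else 1%:M.
have uY j : Y j \in unitmx by rewrite /Y; case: ifP; rewrite ?unitmx1.
have fQ := cycle_frame m' w0 uP.
have letE i : (i < size w)%N ->
    cycle_letter w i = Some (if double_at w i then Double else Ordinary).
  by move=> lti; rewrite /cycle_letter modn_small // double_at_nth.
have YS i : (i < size w)%N -> i != m -> i != m' ->
    [/\ Y i.+1 = Y i, cycle_weight w m Phi i = 1%:M & cycle_weight w m' Phi i =
      1%:M].
  move=> lti im im'; rewrite /cycle_weight modn_small // (negPf im) (negPf im').
  split=> //; rewrite /Y (modn_small lti); have [lt2|ge] := ltnP i.+1 (size w).
    by rewrite modn_small //; congr (if _ then _ else _); lia.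
  have -> : (i.+1 = size w)%N by lia.
  have -> : (m < i <= m')%N = false by lia.
  by rewrite modnn.
have Xm : cycle_weight w m Phi m = Phi /\ cycle_weight w m' Phi m = 1%:M.
  by rewrite /cycle_weight modn_small ?eqxx ?ltn_eqF //; lia.
have Xm' : cycle_weight w m Phi m' = 1%:M /\ cycle_weight w m' Phi m' = Phi.
  by rewrite /cycle_weight modn_small ?eqxx ?gtn_eqF //; lia.
have Ym : Y m = 1%:M /\ Y m.+1 = Phi.
  by split; rewrite /Y modn_small ?ltnn ?ltnSn ?lt //; lia.
have Ym' : Y m' = Phi /\ Y m'.+1 = 1%:M.
  rewrite /Y (modn_small ltm') lt leqnn; split=> //.
  have [lt2|ge] := ltnP m'.+1 (size w); first by rewrite modn_small // ltnn
    andbF.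
  have -> : (m'.+1 = size w)%N by lia.
  by rewrite modnn.
apply: (@frame_iso _ (cycle_mxpair w m' Phi) _ _ _ _ _ _ _
  (fun j => cycle_vec F w k j *m Y j)
  (fun j => invmx (Y j) *m cycle_covec F w k j) (cycle_frame m w0 uP)).
- exact: cycle_annihilating.
- exact: cycle_annihilating.
- by rewrite !cycle_size.
- move=> i lti; have := frame_chain fQ i; rewrite /chain_at letE //.
  have [->|im] := eqVneq i m.
    by rewrite dm; case: Xm Ym => [-> ->] [-> ->]; rewrite !mulmxA !mulmx1 =>
      ->.
  have [->|im'] := eqVneq i m'.
    by rewrite dm'; case: Xm' Ym' => [-> ->] [-> ->]; rewrite !mulmx1.
  have [-> -> ->] := YS i lti im im'; rewrite !mulmx1.
  by case: ifP => _; rewrite mulmxA => ->.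
- move=> i lti; have := frame_cochain fQ i; rewrite /cochain_at letE //.
  have [->|im] := eqVneq i m.
    rewrite dm; case: Xm Ym => [-> ->] [-> ->]; rewrite invmx1 !mul1mx.
    by rewrite mulKVmx.
  have [->|im'] := eqVneq i m'.
    rewrite dm'; case: Xm' Ym' => [-> ->] [-> ->]; rewrite invmx1 !mul1mx.
    by rewrite -mulmxA => ->; rewrite mulKmx.
  have [-> -> ->] := YS i lti im im'; rewrite !mul1mx.
  by case: ifP => _; rewrite -mulmxA => ->.
- by rewrite /Y modnn mod0n -cycle_vec_mod modnn.
- by rewrite /Y modnn mod0n -cycle_covec_mod modnn.
- move=> a b lta ltb; rewrite -mulmxA (mulmxA (cycle_covec _ _ _ _)) cycle_orth
  //.
  rewrite !modn_small //; case: eqP => [->|_]; first by rewrite mul1mx mulVmx.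
  by rewrite mul0mx mulmx0.
Qed.

End Replacement.

(** * Endomorphisms of summands are local, and summands are rigid *)

Section Rigidity.
Variable F : fieldType.

Definition local_end (P : mxpair F) : Prop :=
  forall c1 c2, mxhom P P c1 -> mxhom P P c2 -> c1 + c2 = 1%:M ->
  c1 \in unitmx \/ c2 \in unitmx.

(** Sandwich the intertwining relation of [a] between the covector at one end of the arrow and the
    vector at the other. *)
Lemma frame_diag (P Q : mxpair F) cyc t k k' l (X : nat -> 'M[F]_k)
    (Y : nat -> 'M[F]_k') E E' G G' a i :
  @frame F P cyc t k l X E E' -> @frame F Q cyc t k' l Y G G' ->
  mxhom P Q a ->
  match l i with
  | Some Ordinary => G' i.+1 *m a *m E i.+1 *m X i = Y i *m (G' i *m a *m E i)
  | Some Double => G' i *m a *m E i *m X i = Y i *m (G' i.+1 *m a *m E i.+1)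
  | None => True
  end.
Proof.
move=> fP fQ [aA aB]; have := frame_chain fP i; have := frame_cochain fQ i.
rewrite /chain_at /cochain_at; case: (l i) => [[]|] // h1 h2.
  by rewrite -mulmxA -h2 mulmxA -(mulmxA _ a) aA mulmxA h1 !mulmxA.
by rewrite -mulmxA -h2 mulmxA -(mulmxA _ a) aB mulmxA h1 !mulmxA.
Qed.

Lemma path_diag w c : mxhom (path_mxpair F w) (path_mxpair F w) c ->
  forall i, (i < (size w).+1)%N ->
  path_covec F w i *m c *m path_vec F w i = path_covec F w 0 *m c *m path_vec F
    w 0.
Proof.
move=> hc; elim=> // i IH lti; rewrite -IH; last exact: ltnW.
have := frame_diag i (path_frame F w) (path_frame F w) hc.
rewrite /path_letter -[(i < size w)%N]/(i.+1 < (size w).+1)%N lti.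
by case: nth; rewrite mulmx1 mul1mx.
Qed.

Lemma cycle_diag w m k k' (Phi : 'M[F]_k) (Psi : 'M[F]_k') a :
  (m < size w)%N -> Phi \in unitmx -> Psi \in unitmx ->
  mxhom (cycle_mxpair w m Phi) (cycle_mxpair w m Psi) a ->
  let d i := cycle_covec F w k' i *m a *m cycle_vec F w k i in
  (forall i, (i < size w)%N -> d i = d 0) /\ d 0 *m Phi = Psi *m d 0.
Proof.
move=> ltm uP uQ ha d; have w0 : (0 < size w)%N by lia.
have step i := frame_diag i (cycle_frame m w0 uP) (cycle_frame m w0 uQ) ha.
have dE i : (i < size w)%N -> i != m -> d i.+1 = d i.
  move=> lti im; have := step i; rewrite /cycle_letter /cycle_weight modn_small
    //.
  by rewrite (negPf im); case: nth; rewrite mulmx1 mul1mx.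
have dt : d (size w) = d 0 by rewrite /d /cycle_vec /cycle_covec modnn mod0n.
(* The component is carried up from 0 to [m] and down from [size w], which is 0 again, to [m.+1].
   The arrow [m] is crossed only at the end and yields the relation with [Phi] and [Psi]. *)
have low i : (i <= m)%N -> d i = d 0.
  elim: i => // i IH lti; rewrite dE; [exact: IH (ltnW lti)|lia|lia].
have high j : (j + m < size w)%N -> d (size w - j)%N = d 0.
  elim: j => [|j IH] ltj; first by rewrite subn0.
  rewrite -IH; last by lia.
  have -> : (size w - j = (size w - j.+1).+1)%N by lia.
  by rewrite dE //; lia.
split=> [i lti|].
  have [lei|gti] := leqP i m; first exact: low.
  have -> : (i = size w - (size w - i))%N by lia.
  by apply: high; lia.
have dm1 : d m.+1 = d 0.
  have -> : (m.+1 = size w - (size w - m.+1))%N by lia.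
  by apply: high; lia.
have := step m; rewrite /cycle_letter /cycle_weight modn_small // eqxx.
rewrite -/(d m) -/(d m.+1) dm1 low //.
by case: nth.
Qed.

Lemma frame_end_unit (P : mxpair F) cyc t k l X E E' N c :
  @frame F P cyc t k l X E E' -> annihilating P ->
  (forall i j, (i < t)%N -> (j < t)%N -> key l N i = key l N j -> i = j) ->
  mxhom P P c ->
  (forall i, (i < t)%N -> E' i *m c *m E i = E' 0 *m c *m E 0) ->
  E' 0 *m c *m E 0 \in unitmx -> c \in unitmx.
Proof.
move=> fP [AB _] kinj hc dc u.
apply: (triangular_unitmx (frame_sum fP) kinj) => [i j lti ltj|i lti];
  last first.
  by rewrite dc.
rewrite -mulmxA => nz; apply: (key_le AB (frame_unit fP) (frame_unit fP) _ _
  nz).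
  by move=> r _; apply: frame_cochain fP _.
by move=> r _; apply: mxhom_chain hc (frame_chain fP _).
Qed.

Lemma frame_local_end (P : mxpair F) cyc t k l X E E' N (Phi : 'M[F]_k) :
  @frame F P cyc t k l X E E' -> annihilating P ->
  (forall i j, (i < t)%N -> (j < t)%N -> key l N i = key l N j -> i = j) ->
  frobenius_block Phi ->
  (forall c, mxhom P P c ->
    (forall i, (i < t)%N -> E' i *m c *m E i = E' 0 *m c *m E 0) /\
    E' 0 *m c *m E 0 *m Phi = Phi *m (E' 0 *m c *m E 0)) ->
  local_end P.
Proof.
move=> fP aP kinj fPhi hd c1 c2 h1 h2 c12.
have [d1 p1] := hd _ h1; have [d2 _] := hd _ h2.
have : E' 0 *m c1 *m E 0 + E' 0 *m c2 *m E 0 = 1%:M.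
  by rewrite -mulmxDl -mulmxDr c12 mulmx1 (frame_orth fP) ?eqxx // (frame_gt0
    fP).
have u1 := frame_end_unit fP aP kinj h1 d1; have u2 := frame_end_unit fP aP
  kinj h2 d2.
case/(frobenius_local fPhi p1) => u; [left; exact: u1|right; exact: u2].
Qed.

Lemma summand_local_end (x : summand F) : wf_summand x -> local_end
  (mx_of_summand x).
Proof.
case: x => [w _|w m k Phi [ltm aw _ fPhi uPhi]] /=.
  (* A path takes the 1 by 1 identity as its Frobenius block. *)
  apply: (frame_local_end (N := (size w).+1) (path_frame F w))
    (@path_annihilating F w) _ (frobenius_block1 F) _.
    by move=> i j lti ltj; apply: key_path_inj.
  by move=> c hc; split; [exact: path_diag|rewrite mulmx1 mul1mx].
have w0 : (0 < size w)%N by lia.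
apply: (frame_local_end (N := (size w).*2) (cycle_frame m w0 uPhi))
  (cycle_annihilating _ _ _) _ fPhi _.
  by move=> i j; apply: key_cycle_inj.
by move=> c hc; apply: cycle_diag.
Qed.

Lemma mul_neq0 m n p (a : 'M[F]_(m, n)) (b : 'M_(n, p)) :
  a *m b != 0 -> a != 0 /\ b != 0.
Proof.
by move=> nz; split; apply: contraNneq nz => ->; rewrite ?mul0mx ?mulmx0.
Qed.

Section Retract.
Variables (P Q : mxpair F) (cyc cyc' : bool) (t t' k k' : nat).
Variables (l l' : nat -> option arrow) (X : nat -> 'M[F]_k) (Y : nat ->
  'M[F]_k').
Variables (E : nat -> 'M[F]_(mxsize P, k)) (E' : nat -> 'M[F]_(k, mxsize P)).
Variables (G : nat -> 'M[F]_(mxsize Q, k')) (G' : nat -> 'M[F]_(k', mxsize Q)).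
Variables (a : 'M[F]_(mxsize Q, mxsize P)) (b : 'M[F]_(mxsize P, mxsize Q)).
Hypotheses (fP : frame cyc t l X E E') (fQ : frame cyc' t' l' Y G G').
Hypotheses (aP : annihilating P) (aQ : annihilating Q).
Hypotheses (ha : mxhom P Q a) (hb : mxhom Q P b) (ba : b *m a = 1%:M).

(** Both factors are nonzero pairings, in opposite directions, so the keys bound each other. *)
Lemma retract_key N j : (E' 0 *m b *m G j) *m (G' j *m a *m E 0) != 0 ->
  key l N 0 = key l' N j.
Proof.
case/mul_neq0=> nb na; apply/eqP; rewrite eqn_leq; apply/andP; split.
  rewrite -mulmxA in nb; apply: (key_le (proj1 aP) (frame_unit fP) (frame_unit
    fQ) _ _ nb).
    by move=> r _; apply: frame_cochain fP _.
  by move=> r _; apply: mxhom_chain hb (frame_chain fQ _).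
rewrite -mulmxA in na; apply: (key_le (proj1 aQ) (frame_unit fQ) (frame_unit
  fP) _ _ na).
  by move=> r _; apply: frame_cochain fQ _.
by move=> r _; apply: mxhom_chain ha (frame_chain fP _).
Qed.

Lemma retract_sum :
  \sum_(j < t') (E' 0 *m b *m G j) *m (G' j *m a *m E 0) = 1%:M.
Proof.
have <- : E' 0 *m b *m 1%:M *m (a *m E 0) = 1%:M.
  rewrite mulmx1 mulmxA -(mulmxA (E' 0)) ba mulmx1.
  by rewrite (frame_orth fP) ?eqxx // (frame_gt0 fP).
rewrite -(frame_sum fQ) mulmx_sumr mulmx_suml.
by apply: eq_bigr => j _; rewrite !mulmxA.
Qed.

(** Some term of [retract_sum] is nonzero; its index does not depend on [N], so the words agree at
    every length. *)
Lemma retract_match : (0 < k)%N ->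
  exists i, [/\ (i < t')%N, G' i *m a *m E 0 != 0, E' 0 *m b *m G i != 0 &
                forall N, key l N 0 = key l' N i].
Proof.
move=> k0; have E1 := retract_sum.
case: (pickP (fun i : 'I_t' => (E' 0 *m b *m G i) *m (G' i *m a *m E 0) != 0)).
  move=> i nz; exists i; have [nb na] := mul_neq0 nz; split=> // N.
  exact: retract_key.
move=> z; move: E1; rewrite big1 => [/esym|i _]; last first.
  by apply/eqP; rewrite -[_ == _]negbK z.
move=> /(congr1 (fun M : 'M_k => M (Ordinal k0) (Ordinal k0))).
by rewrite !mxE eqxx => /eqP; rewrite oner_eq0.
Qed.

Lemma retract_vertex N : l = l' ->
  (forall j, (j < t')%N -> key l N 0 = key l N j -> j = 0%N) ->
  (E' 0 *m b *m G 0) *m (G' 0 *m a *m E 0) = 1%:M.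
Proof.
move=> el kinj; rewrite -[RHS]retract_sum (bigD1 (Ordinal (frame_gt0 fQ))) //=.
rewrite [X in _ + X]big1 ?addr0 // => j j0; apply/eqP; apply: contraNT j0 => nz.
by apply/eqP/val_inj/kinj; [exact: ltn_ord|rewrite (retract_key N nz) el].
Qed.
End Retract.

Definition summand_equiv (x y : summand F) : Prop := sum_equiv [:: x] [:: y].

Lemma replacement_wf (x y : summand F) :
  replacement x y -> wf_summand x -> wf_summand y.
Proof.
case=> [w m k Phi i lti|w m m' k Phi dm dm'] [ltm aw dw fP uP].
  split=> //=; first by rewrite size_rotr ltn_mod; lia.
    exact: aperiodic_rotr.
  case=> j dj; rewrite double_at_rotr //; apply: dw.
  have ltj : (j < size (rotr i w))%N.
    by move: dj; rewrite /double_at; case: ltnP => // ?; rewrite nth_default.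
  move: ltj dj; rewrite size_rotr => ltj.
  (* This is [j - i] modulo [size w], the arrow before renumbering. *)
  exists ((j + (size w - i)) %% size w)%N.
  rewrite -(double_at_rotr lti) ?ltn_mod; last by lia.
  rewrite modnDml -addnA subnK; last exact: ltnW.
  by rewrite modnDr modn_small.
split=> //=; move: dm'; rewrite /double_at; case: ltnP => // ?.
by rewrite nth_default.
Qed.

Lemma replacement_iso (x y : summand F) : wf_summand x ->
  replacement x y -> isomorphic (mx_of_summand x) (mx_of_summand y).
Proof.
move=> wx r; case: r wx => [w m k Phi i lti|w m m' k Phi dm dm'] [ltm aw dw fP
  uP].
  exact: renumber_iso.
exact: transfer_iso.
Qed.

Lemma path_split_eq w w' a b : let P := path_mxpair F w in
  let Q := path_mxpair F w' in
  mxhom P Q a -> mxhom Q P b -> b *m a = 1%:M -> w = w'.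
Proof.
move=> P Q ha hb ba.
have [fP fQ] := (path_frame F w, path_frame F w').
have [aP aQ] := (@path_annihilating F w, @path_annihilating F w').
have [i [lti na nb kE]] := retract_match fP fQ aP aQ ha hb ba isT.
(* Keys compare words only to the right, so the left ends are aligned separately. A vertex reached
   by an ordinary arrow lies in the image of [A], and the first covector of [P] kills [A]; one
   reached by a double arrow has its covector in the row space of [B], and [B] kills the first
   vector of [P]. *)
have i0 : i = 0%N.
  case: i lti na nb {kE} => // i lti na nb.
  have := frame_chain fQ i; have := frame_cochain fQ i.
  rewrite /chain_at /cochain_at /path_letter -[(i < size w')%N]/(i.+1 < (size
    w').+1)%N lti.
  case: nth; rewrite mulmx1 mul1mx => c c'.
    move: nb; rewrite -c' -mulmxA (mulmxA b) (proj1 hb) !mulmxA (frame_coclosed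
      fP).
    by rewrite !mul0mx eqxx.
  move: na; rewrite -c -!mulmxA (mulmxA _ a) -(proj2 ha) -mulmxA (frame_closed
    fP).
  by rewrite !mulmx0 eqxx.
rewrite {}i0 in kE {lti na nb}.
have lE m : (m <= size w)%N -> path_letter w m = path_letter w' m.
  move=> ltm; apply: (@key_eq _ _ m.+1 0 0) => // r ltr;
    rewrite /path_letter add0n ifT //.
  by lia.
have lE' m : (m <= size w')%N -> path_letter w m = path_letter w' m.
  move=> ltm; symmetry; apply: (@key_eq _ _ m.+1 0 0) => // r ltr.
  by rewrite /path_letter add0n ifT //; lia.
have sE : size w = size w'.
  apply/eqP; rewrite eqn_leq; apply/andP; split.
    have := lE' _ (leqnn _); rewrite /path_letter ltnn; case: ltnP => //.
  by have := lE _ (leqnn _); rewrite /path_letter ltnn; case: ltnP.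
apply: (@eq_from_nth _ Ordinary) => // r ltr; have := lE _ (ltnW ltr).
by rewrite /path_letter -sE ltr => -[].
Qed.

Lemma cycle_split_eq w m k k' (Phi : 'M[F]_k) (Psi : 'M[F]_k') a b :
  let P := cycle_mxpair w m Phi in let Q := cycle_mxpair w m Psi in
  aperiodic w -> (m < size w)%N -> Phi \in unitmx -> Psi \in unitmx ->
  frobenius_block Phi -> frobenius_block Psi ->
  mxhom P Q a -> mxhom Q P b -> b *m a = 1%:M ->
  existT (fun k => 'M[F]_k) k Phi = existT (fun k => 'M[F]_k) k' Psi.
Proof.
move=> P Q aw ltm uP uQ fPhi fPsi ha hb ba; have w0 : (0 < size w)%N by lia.
have [fP fQ] := (cycle_frame m w0 uP, cycle_frame m w0 uQ).
have [aP aQ] := (cycle_annihilating w m Phi, cycle_annihilating w m Psi).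
have [[_ da] [_ db]] := (cycle_diag ltm uP uQ ha, cycle_diag ltm uQ uP hb).
apply: (frobenius_retract_eq fPhi fPsi da db).
apply: (retract_vertex fP fQ aP aQ ha hb ba (N := (size w).*2)) => // j ltj kE.
exact: esym (key_cycle_inj aw w0 ltj kE).
Qed.

Lemma summand_retract_equiv (x y : summand F) a b :
  wf_summand x -> wf_summand y ->
  mxhom (mx_of_summand x) (mx_of_summand y) a ->
  mxhom (mx_of_summand y) (mx_of_summand x) b -> b *m a = 1%:M ->
  summand_equiv x y.
Proof.
have refl s : @sum_equiv F s s by apply: EquivPermute; apply: Permutation_refl.
have step x1 y1 : replacement x1 y1 -> summand_equiv x1 y1.
  exact: (@EquivReplace _ [::] x1 y1 [::]).
case: x a b => [w|w m k Phi]; case: y => [w'|w' m' k' Psi] a b.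
- by move=> _ _ ha hb ba; rewrite (path_split_eq ha hb ba); apply: refl.
- move=> _ [ltm' aw' _ fPsi uPsi] ha hb ba; have w0' : (0 < size w')%N by lia.
  have [i [_ _ _ kE]] := retract_match (path_frame F w) (cycle_frame m' w0'
    uPsi)
    (@path_annihilating F w) (cycle_annihilating w' m' Psi) ha hb ba isT.
  (* The word of a path ends, that of a cycle does not. *)
  have : path_letter w (0 + size w) = cycle_letter w' (i + size w).
    apply: (@key_eq _ _ (size w).+1) => // r ltr.
    by rewrite /path_letter add0n ifT.
  by rewrite /path_letter add0n ltnn.
- move=> [ltm aw _ fPhi uPhi] _ ha hb ba; have w0 : (0 < size w)%N by lia.
  have [i [lti _ _ kE]] := retract_match (cycle_frame m w0 uPhi) (path_frame F
    w')
    (cycle_annihilating w m Phi) (@path_annihilating F w') ha hb ba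
    (frobenius_block_gt0 fPhi).
  have : cycle_letter w (0 + (size w' - i)) = path_letter w' (i + (size w' -
    i)).
    by apply: (@key_eq _ _ (size w').+1) => //; lia.
  by rewrite /path_letter subnKC // ltnn.
move=> wx wy ha hb ba; have [ltm aw dw fPhi uPhi] := wx.
have [ltm' aw' dw' fPsi uPsi] := wy.
have w0 : (0 < size w)%N by lia. have w0' : (0 < size w')%N by lia.
have [i [lti _ _ kE]] := retract_match (cycle_frame m w0 uPhi)
  (cycle_frame m' w0' uPsi) (cycle_annihilating w m Phi)
  (cycle_annihilating w' m' Psi) ha hb ba (frobenius_block_gt0 fPhi).
have ew : w' = rotr i w.
  apply: cycle_letter_eq => // r; rewrite -[r in LHS]add0n.
  exact: (@key_eq _ _ r.+1 0 i (kE _) r (ltnSn _)).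
subst w'; rewrite size_rotr in lti ltm'.
have r1 := @Renumber F w m k Phi i lti.
have w1 := replacement_wf r1 wx.
(* This summand has the word and the marked arrow of the second one and the block of the first; only
   the blocks then remain to be compared. *)
pose x1 := Cycle (rotr i w) m' Phi.
have [e1 [w2 i2]] : summand_equiv (Cycle w m Phi) x1 /\
    (wf_summand x1 /\ isomorphic (cycle_mxpair w m Phi) (mx_of_summand x1)).
  have i1 := replacement_iso wx r1.
  have [em|nm] := eqVneq ((m + i) %% size w)%N m'.
    by rewrite /x1 -em; split; [exact: step|split].
  have r2 : replacement (Cycle (rotr i w) ((m + i) %% size w) Phi) x1.
    (* Without double arrows the word is constant, aperiodicity leaves one vertex, and the marked
       arrows coincide. *)
    have ex : exists j, double_at (rotr i w) j.
      apply: NNPP => nex; case/eqP: nm.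
      have /(aperiodic_dvd aw' w0') : forall r, nth Ordinary (rotr i w)
          ((r + 1) %% size (rotr i w)) = nth Ordinary (rotr i w) (r %% size
            (rotr i w)).
        by move=> r; rewrite !double_at_nth !ifF //; apply/negP => dj;
          apply: nex;
          [exists (r %% size (rotr i w))%N | exists ((r + 1) %% size (rotr i
            w))%N].
      rewrite dvdn1 size_rotr => /eqP s1; move: ltm'.
      by rewrite s1 modn1; case: (m').
    by apply: Transfer; [case: w1 => _ _ ->|exact: dw'].
  split; last split.
  - exact: EquivTrans (step _ _ r1) (step _ _ r2).
  - exact: replacement_wf r2 w1.
  - exact: isomorphic_trans i1 (replacement_iso w1 r2).
have [c [d [hc hd [cd dc]]]] := i2.
have E1 : (c *m b) *m (a *m d) = 1%:M by rewrite mulmxA -(mulmxA c) ba mulmx1.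
have [_ _ _ _ _] := w2.
have := @cycle_split_eq (rotr i w) m' k k' Phi Psi (a *m d) (c *m b)
  (aperiodic_rotr aw)
  _ uPhi uPsi fPhi fPsi (mxhomM hd ha) (mxhomM hb hc) E1.
rewrite size_rotr => /(_ ltm') ePhi.
have -> : Cycle (rotr i w) m' Psi = x1; last exact: e1.
exact: (congr1 (fun s : {k & 'M[F]_k} => Cycle (rotr i w) m' (projT2 s)) (esym
  ePhi)).
Qed.

End Rigidity.

(** * Uniqueness *)

(** [s - r *m d *m q] is the Schur complement of [p]. It permits cancelling a summand although [s],
    the other diagonal block, may be singular: the isomorphism of the complements is the block [s']
    of the inverse. *)
Lemma schur_inverse (F : fieldType) m n m' n' (p : 'M[F]_(m', m))
    (q : 'M_(m', n)) (r : 'M_(n', m)) (s : 'M_(n', n)) p' q' r' s' d :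
  inverse_mx (block_mx p q r s) (block_mx p' q' r' s') -> inverse_mx p d ->
  inverse_mx s' (s - r *m d *m q).
Proof.
rewrite /inverse_mx !mulmx_block !scalar_mx_block.
move=> [/eq_block_mx[_ e2 _ e4] /eq_block_mx[_ _ e3' e4']] [pd dp].
have sr : s' *m r = - (r' *m p) by apply/eqP; rewrite -addr_eq0 addrC e3'.
have qs : q *m s' = - (p *m q') by apply/eqP; rewrite -addr_eq0 addrC e2.
split; rewrite (mulmxBl, mulmxBr).
  by rewrite !mulmxA sr mulNmx -(mulmxA r') pd mulmx1 mulNmx opprK addrC.
by rewrite -(mulmxA _ q) qs mulmxN -!mulmxA (mulmxA d) dp mul1mx opprK addrC.
Qed.

Section Uniqueness.
Variable F : fieldType.
Implicit Types (x y : summand F) (s : seq (summand F)).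

Lemma sum_equiv_refl s : sum_equiv s s.
Proof. by apply: EquivPermute; apply: Permutation_refl. Qed.

Lemma sum_equiv_cons x s s' : sum_equiv s s' -> sum_equiv (x :: s) (x :: s').
Proof.
elim=> [r r' p|r1 y z r2 yz|r r' r'' _ IH1 _ IH2].
- by apply: EquivPermute; apply: perm_skip.
- exact: (@EquivReplace _ (x :: r1)).
- exact: EquivTrans IH1 IH2.
Qed.

Lemma sum_equiv_catr s s' r : sum_equiv s s' -> sum_equiv (s ++ r) (s' ++ r).
Proof.
elim=> [t t' p|r1 y z r2 yz|t t' t'' _ IH1 _ IH2].
- by apply: EquivPermute; apply: Permutation_app_tail.
- by rewrite -!catA !cat_cons; apply: EquivReplace.
- exact: EquivTrans IH1 IH2.
Qed.

Lemma sum_equiv_wf s s' : sum_equiv s s' -> wf_sum s -> wf_sum s'.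
Proof.
elim=> [r r' p|r1 y z r2 yz|r r' r'' _ IH1 _ IH2]; last by move/IH1.
  exact: Permutation_Forall.
rewrite /wf_sum => /List.Forall_app[w1 /List.Forall_cons_iff[wy w2]].
apply/List.Forall_app; split=> //; constructor=> //.
exact: replacement_wf yz wy.
Qed.

Lemma sum_equiv_iso s s' : wf_sum s -> sum_equiv s s' ->
  isomorphic (mxsum s) (mxsum s').
Proof.
move=> + e; elim: e => [r r' p _|r1 y z r2 yz|r r' r'' e1 IH1 _ IH2 wr].
- elim: p => [|x t t' _ IH|x y t|t t' t'' _ IH1 _ IH2].
  + exact: isomorphic_refl.
  + by apply: isomorphic_dsum => //; exact: isomorphic_refl.
  + exact: isomorphic_dsumCA.
  + exact: isomorphic_trans IH1 IH2.
- elim: r1 => [|x t IH] /List.Forall_cons_iff[wx wt].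
    apply: isomorphic_dsum; [exact: replacement_iso|exact: isomorphic_refl].
  by apply: isomorphic_dsum; [exact: isomorphic_refl|exact: IH].
- exact: isomorphic_trans (IH1 wr) (IH2 (sum_equiv_wf e1 wr)).
Qed.

Lemma summand_size_gt0 x : wf_summand x -> (0 < mxsize (mx_of_summand x))%N.
Proof.
case: x => [w|w m k Phi] //= [ltm _ _ /frobenius_block_gt0 k0 _].
by rewrite sum_nat_const card_ord muln_gt0 k0; lia.
Qed.

(** By locality, some component of a split monomorphism from a summand to a
    sum is invertible. *)
Lemma retract_summand x s a b : wf_summand x -> wf_sum s ->
  mxhom (mx_of_summand x) (mxsum s) a -> mxhom (mxsum s) (mx_of_summand x) b ->
  b *m a = 1%:M ->
  exists y s' (u : 'M[F]_(mxsize (mx_of_summand y) + mxsize (mxsum s'),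
    mxsize (mxsum s))),
    [/\ Permutation s (y :: s'), summand_equiv x y,
        mxhom (mxsum s) (mxsum (y :: s')) u, exists u', inverse_mx u u' &
        exists d, inverse_mx (usubmx (u *m a)) d].
Proof.
move=> wx; elim: s a b => [|y s IH] a b.
  by move=> _ _ _ /mulmx1_min; rewrite leqNgt summand_size_gt0.
move=> /List.Forall_cons_iff[wy ws] ha hb ba.
have h1 := mxhomM (mxhom_usub ha) (mxhom_lsub hb).
have h2 := mxhomM (mxhom_dsub ha) (mxhom_rsub hb).
have inv1 c : c \in unitmx -> mxhom (mx_of_summand x) (mx_of_summand x) c ->
    mxhom (mx_of_summand x) (mx_of_summand x) (invmx c).
  by move=> u hc; apply: (mxhom_inv hc); split; rewrite ?mulmxV ?mulVmx.
have [] : lsubmx b *m usubmx a \in unitmx \/ rsubmx b *m dsubmx a \in unitmx.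
- apply: (summand_local_end wx h1 h2).
  by rewrite -ba -[b in RHS]hsubmxK -[a in RHS]vsubmxK mul_row_col.
- move=> u; have hb1 := mxhomM (mxhom_lsub hb) (inv1 _ u h1).
  have ba1 : invmx (lsubmx b *m usubmx a) *m lsubmx b *m usubmx a = 1%:M.
    by rewrite -mulmxA mulVmx.
  have e := summand_retract_equiv wx wy (mxhom_usub ha) hb1 ba1.
  exists y, s, 1%:M; split=> //.
  + exact: mxhom1.
  + by exists 1%:M; split; rewrite mulmx1.
  + exists (invmx (lsubmx b *m usubmx a) *m lsubmx b); rewrite mul1mx;
    split=> //.
    (* The one-sided inverse is two-sided because equivalent summands have equal sizes. *)
    apply: (mulmx1C_eq_size _ ba1).
    have wx1 : wf_sum [:: x] by constructor.
    have [c [d [_ _ cd]]] := sum_equiv_iso wx1 e.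
    by have := mulmx1_eq_size cd; rewrite /= !addn0 => ->.
- move=> u; have hb2 := mxhomM (mxhom_rsub hb) (inv1 _ u h2).
  have ba2 : invmx (rsubmx b *m dsubmx a) *m rsubmx b *m dsubmx a = 1%:M.
    by rewrite -mulmxA mulVmx.
  have [z [s' [v [p e hv [v' vv'] [d vd]]]]] := IH _ _ ws (mxhom_dsub ha) hb2
    ba2.
  exists z, (y :: s'), (mxswapCA F _ _ _ *m block_mx 1%:M 0 0 v); split=> //.
  + exact: Permutation.perm_trans (perm_skip _ p) (perm_swap _ _ _).
  + apply: mxhomM (mxhom_swapCA _ _ _); exact: mxhom_dsum (mxhom1 _) hv.
  + exists (block_mx 1%:M 0 0 v' *m mxswapCA F _ _ _).
    apply: inverse_mxM; first by split; exact: mxswapCAK.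
    case: vv' => vv' v'v; rewrite /inverse_mx !mulmx_block.
    by rewrite !mul0mx !mulmx0 !mulmx1 !addr0 !add0r vv' v'v -!scalar_mx_block.
  + exists d; rewrite -mulmxA -[a in block_mx _ _ _ _ *m a]vsubmxK
    mul_block_col.
    rewrite !mul0mx mul1mx addr0 add0r -[v *m _]vsubmxK mul_swapCA_col.
    by rewrite col_mxKu.
Qed.

Lemma cancel_dsum (P P' M M' : mxpair F) u u' d :
  mxhom (mxdsum P M) (mxdsum P' M') u -> inverse_mx u u' ->
  inverse_mx (ulsubmx (u : 'M_(_ + _, _ + _))) d -> isomorphic M M'.
Proof.
move=> hu uu' pd; have hu' := mxhom_inv hu uu'.
apply: isomorphic_sym; exists (drsubmx (u' : 'M_(_ + _, _ + _))).
have hs : mxhom M' M (drsubmx (u' : 'M_(_ + _, _ + _))).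
  exact: mxhom_rsub (mxhom_dsub hu').
rewrite -[X in inverse_mx X _]submxK -[X in inverse_mx _ X]submxK in uu'.
have iS := schur_inverse uu' pd.
by eexists; split; [exact: hs|exact: mxhom_inv hs iS|exact: iS].
Qed.

Lemma isomorphic_sum_equiv s s' : wf_sum s -> wf_sum s' ->
  isomorphic (mxsum s) (mxsum s') -> sum_equiv s s'.
Proof.
elim: s s' => [|x s IH] s'.
  case: s' => [_ _ _|y s' _ /List.Forall_cons_iff[wy _] [a [b [_ _
    /mulmx1_eq_size]]]].
    exact: sum_equiv_refl.
  by have := summand_size_gt0 wy; rewrite /=; lia.
move=> /List.Forall_cons_iff[wx ws] ws' [u [u' [hu hu' uu']]].
have ha := mxhomM (mxhom_col (mxhom1 (mx_of_summand x)) (mxhom0 _ (mxsum s)))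
  hu.
have hb := mxhomM hu' (mxhom_row (mxhom1 (mx_of_summand x)) (mxhom0 (mxsum s)
  _)).
have [|y [s1 [v [p e hv [v' vv'] [d vd]]]]] := retract_summand wx ws' ha hb.
  rewrite mulmxA -(mulmxA (row_mx _ _)) (proj2 uu') mulmx1.
  by rewrite mul_row_col mul1mx mul0mx addr0.
have hvu := mxhomM hu hv; have ivu := inverse_mxM vv' uu'.
have /(cancel_dsum hvu ivu) ss1 : inverse_mx (ulsubmx (v *m u : 'M_(_ + _,
  _ + _))) d.
  have -> : ulsubmx (v *m u : 'M_(_ + _, _ + _)) = usubmx (lsubmx (v *m u :
    'M_(_, _ + _))).
    by apply/matrixP => i j; rewrite !mxE.
  move: vd; rewrite mulmxA -[v *m u in X in X -> _](hsubmxK (v *m u : 'M_(_,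
    _ + _))).
  by rewrite mul_row_col mulmx1 mulmx0 addr0.
have /List.Forall_cons_iff[_ ws1] : wf_sum (y :: s1) by exact:
  Permutation_Forall ws'.
apply: EquivTrans (sum_equiv_cons x (IH _ ws ws1 ss1)) _.
apply: EquivTrans (sum_equiv_catr s1 e) _.
by apply: EquivPermute; apply: Permutation_sym.
Qed.

End Uniqueness.

(** * Existence: splitting off a path *)

(** The complement is the image of the idempotent [e]; a full rank factorization [C *m D] of [e]
    provides coordinates on it. *)
Lemma split_retract (F : fieldType) (P Q : mxpair F) a b :
  annihilating P -> mxhom Q P a -> mxhom P Q b -> b *m a = 1%:M ->
  exists P', annihilating P' /\ isomorphic P (mxdsum Q P').
Proof.
move=> [AB BA] [aA aB] [bA bB] ba; pose e := 1%:M - a *m b.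
have be : b *m e = 0 by rewrite mulmxBr mulmx1 mulmxA ba mul1mx subrr.
have ea : e *m a = 0 by rewrite mulmxBl mul1mx -mulmxA ba mulmx1 subrr.
have [r [C [D [CD freeD fullC]]]] : exists r (C : 'M[F]_(_, r)) (D : 'M_(r, _)),
    [/\ C *m D = e, row_free D & row_full C].
  exists (\rank e), (col_base e), (row_base e).
  by split; [exact: mulmx_base|exact: row_base_free|exact: col_base_full].
have D0 m (z : 'M_(m, r)) : z *m D = 0 -> z = 0.
  by move=> zD; apply: (row_free_inj freeD); rewrite zD mul0mx.
have C0 m (z : 'M_(r, m)) : C *m z = 0 -> z = 0.
  by move=> Cz; apply: (row_full_inj fullC); rewrite Cz mulmx0.
have bC : b *m C = 0 by apply: D0; rewrite -mulmxA CD.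
have Da : D *m a = 0 by apply: C0; rewrite mulmxA CD.
have DC : D *m C = 1%:M.
  apply: (row_free_inj freeD); rewrite -mulmxA CD /e mulmxBr mulmx1 mulmxA Da.
  by rewrite mul0mx subr0 mul1mx.
pose P' := MxPair (D *m mxA P *m C) (D *m mxB P *m C).
have DAe : D *m mxA P *m e = D *m mxA P.
  by rewrite mulmxBr mulmx1 !mulmxA -(mulmxA D) -aA mulmxA Da !mul0mx subr0.
have DBe : D *m mxB P *m e = D *m mxB P.
  by rewrite mulmxBr mulmx1 !mulmxA -(mulmxA D) -aB mulmxA Da !mul0mx subr0.
have hc : mxhom P (mxdsum Q P') (col_mx b D).
  by apply: mxhom_col; split; rewrite //= -mulmxA CD ?DAe ?DBe.
exists P'; split.
  split; rewrite /P' /= !mulmxA -(mulmxA _ C D) CD ?DAe ?DBe.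
    by rewrite -(mulmxA D) AB mulmx0 mul0mx.
  by rewrite -(mulmxA D) BA mulmx0 mul0mx.
have ic : inverse_mx (col_mx b D) (row_mx a C).
  split; first by rewrite mul_col_row ba bC Da DC -scalar_mx_block.
  by rewrite mul_row_col CD addrC subrK.
by exists (col_mx b D), (row_mx a C); split=> //; exact: mxhom_inv hc ic.
Qed.

Section Preimages.
Variables (F : fieldType) (n : nat) (A B : 'M[F]_n).

(** The row vectors [f] from which a cochain along [u] leads into the row
    space [S]. *)
Fixpoint pre (u : seq arrow) (S : 'M[F]_n) : 'M[F]_n :=
  match u with
  | [::] => S
  | Ordinary :: u' => pre u' S *m A
  | Double :: u' => kermx (B *m cokermx (pre u' S))
  end.

Lemma sub_ker_coker m (f : 'M[F]_(m, n)) (S : 'M_n) :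
  (f <= kermx (B *m cokermx S))%MS = (f *m B <= S)%MS.
Proof. by apply/sub_kermxP/idP; rewrite submxE mulmxA => /eqP. Qed.

Lemma pre_cat u v S : pre (u ++ v) S = pre u (pre v S).
Proof.
elim: u => [|c u IH]; first by [].
by case: c; rewrite /= IH.
Qed.

Lemma pre_mono u (S T : 'M[F]_n) : (S <= T)%MS -> (pre u S <= pre u T)%MS.
Proof.
move=> ST; elim: u => [|c u IH]; first by [].
case: c => /=; first exact: submxMr.
by rewrite sub_ker_coker (submx_trans _ IH) // -sub_ker_coker.
Qed.

Local Notation one := (fun=> 1%:M).

Lemma pre_cochain u S k (f : 'M[F]_(k, n)) : (f <= pre u S)%MS ->
  exists g, [/\ g 0%N = f, (g (size u) <= S)%MS &
    forall i, (i < size u)%N -> cochain_at A B (path_letter u) one g i].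
Proof.
elim: u f => [|c u IH] f /=; first by move=> fS; exists (fun=> f).
case: c => [/submxP[D ->]|]; last rewrite sub_ker_coker => fB.
  have [|g [g0 gS gc]] := IH (D *m pre u S); first exact: submxMl.
  exists (fun i => if i is i'.+1 then g i' else D *m (pre u S *m A)).
  split=> // -[_|i lti]; last exact: gc.
  by rewrite /cochain_at /= g0 mul1mx mulmxA.
have [g [g0 gS gc]] := IH _ fB.
exists (fun i => if i is i'.+1 then g i' else f); split=> // -[_|i lti];
  last exact: gc.
by rewrite /cochain_at /= g0 mul1mx.
Qed.

Lemma cochain_pre u S k (g : nat -> 'M[F]_(k, n)) : (g (size u) <= S)%MS ->
  (forall i, (i < size u)%N -> cochain_at A B (path_letter u) one g i) ->
  (g 0%N <= pre u S)%MS.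
Proof.
elim: u g => [|c u IH] g //= gS gc.
have {IH} IH : (g 1%N <= pre u S)%MS.
  by apply: (IH (fun i => g i.+1)) => // i lti; apply: (gc i.+1).
have := gc 0%N isT; rewrite /cochain_at /=; case: c {gc}; rewrite mul1mx => e.
  by rewrite -e submxMr.
by rewrite sub_ker_coker e.
Qed.

(** A double annihilator: the columns killed by the left kernel form the column space, by comparing
    ranks after transposition. *)
Lemma kermx_mul0 m p k (M : 'M[F]_(m, p)) (v : 'M_(m, k)) :
  kermx M *m v = 0 -> exists h, v = M *m h.
Proof.
move=> Mv; suff /submxP[D Dv] : (v^T <= M^T)%MS.
  by exists D^T; apply: trmx_inj; rewrite Dv trmx_mul trmxK.
have MK : (M^T <= kermx (kermx M)^T)%MS.
  by apply/sub_kermxP; rewrite -trmx_mul mulmx_ker trmx0.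
have : (kermx (kermx M)^T <= M^T)%MS.
  rewrite -(geq_leqif (mxrank_leqif_sup MK)) mxrank_ker !mxrank_tr mxrank_ker.
  by rewrite subKn // rank_leq_row.
by apply: submx_trans; apply/sub_kermxP; rewrite -trmx_mul Mv trmx0.
Qed.

Lemma pre_chain u S k (v : 'M[F]_(n, k)) : pre u S *m v = 0 ->
  exists h, [/\ h 0%N = v, S *m h (size u) = 0 &
    forall i, (i < size u)%N -> chain_at A B (path_letter u) one h i].
Proof.
elim: u v => [|c u IH] v /=; first by move=> Sv; exists (fun=> v).
case: c => [|/kermx_mul0[z ->]].
  rewrite -mulmxA => /IH[h [h0 hS hc]].
  exists (fun i => if i is i'.+1 then h i' else v); split=> // -[_|i lti];
    last exact: hc.
  by rewrite /chain_at /= h0 mulmx1.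
have [|h [h0 hS hc]] := IH (cokermx (pre u S) *m z);
  first by rewrite mulmxA mulmx_coker mul0mx.
exists (fun i => if i is i'.+1 then h i' else B *m cokermx (pre u S) *m z).
split=> // -[_|i lti]; last exact: hc.
by rewrite /chain_at /= h0 mulmx1 mulmxA.
Qed.

Lemma sub_pairing m p (S : 'M[F]_(m, n)) (T : 'M_(p, n)) : ~~ (S <= T)%MS ->
  exists (f : 'rV_n) (v : 'cV_n), [/\ (f <= S)%MS, T *m v = 0 & f *m v = 1%:M].
Proof.
rewrite submxE => /eqP nz.
have [i [j ij]] : exists i j, (S *m cokermx T) i j != 0.
  apply: NNPP => none; apply: nz; apply/matrixP => i j; rewrite [RHS]mxE.
  by apply/eqP; apply: contra_notT none => ij; exists i, j.
exists (((S *m cokermx T) i j)^-1 *: row i S), (col j (cokermx T)); split.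
- by rewrite scalemx_sub // row_sub.
- by rewrite colE mulmxA mulmx_coker mul0mx.
apply/matrixP => a b; rewrite !ord1 -scalemxAl colE mulmxA -row_mul -colE.
by rewrite [LHS]mxE [X in _ * X]mxE [X in _ * X]mxE mulVf // [RHS]mxE eqxx.
Qed.

(** In the first case a path starts at the left end of a nonzero pairing, in the
    other two the pairing extends to the left along an arrow. *)
Lemma extend_left (S T : 'M[F]_n) : (T <= S)%MS -> ~~ (S <= T)%MS ->
  [\/ ~~ (S :&: kermx A <= T + B)%MS, ~~ (pre [:: Ordinary] S <= pre [::
    Ordinary] T)%MS
    | ~~ (pre [:: Double] S <= pre [:: Double] T)%MS].
Proof.
move=> TS nST; apply: NNPP => none; move/negP: nST; apply.
have h1 : (S :&: kermx A <= T + B)%MS.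
  by apply: contra_notT none => h; constructor 1.
have h2 : (S *m A <= T *m A)%MS by apply: contra_notT none => h; constructor 2.
have h3 : (pre [:: Double] S <= pre [:: Double] T)%MS.
  by apply: contra_notT none => h; constructor 3.
(* Modulo [T], the space [S] falls into [kermx A] by [h2], then into the row space of [B] by [h1],
   and there into [T] by [h3]. *)
have /submxP[D SD] := h2.
have dS : (S - D *m T <= S)%MS by rewrite addmx_sub // eqmx_opp (submx_trans _
  TS) // submxMl.
have : (S - D *m T <= T + B)%MS.
  apply: submx_trans h1; rewrite sub_capmx dS; apply/sub_kermxP.
  by rewrite mulmxBl SD mulmxA subrr.
case/sub_addsmxP=> -[X Y] /= e.
have YB : (Y *m B <= T)%MS.
  rewrite -sub_ker_coker; apply: submx_trans h3; rewrite sub_ker_coker.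
  have -> : Y *m B = S - D *m T - X *m T by rewrite e addrC addKr.
  by rewrite addmx_sub // eqmx_opp (submx_trans _ TS) // submxMl.
have -> : S = D *m T + (X *m T + Y *m B) by rewrite -e addrC subrK.
by rewrite !addmx_sub // submxMl.
Qed.

End Preimages.

(** Only the pairings at equal vertices are prescribed: [b *m a] is triangular with identity
    diagonal, and its inverse corrects [b] to a retraction. *)
Lemma frame_split (F : fieldType) (P Q : mxpair F) cyc t k l X
    (E : nat -> 'M[F]_(mxsize Q, k)) E' N (v : nat -> 'M[F]_(mxsize P, k)) f :
  frame cyc t l X E E' -> annihilating P -> annihilating Q ->
  (forall i j, (i < t)%N -> (j < t)%N -> key l N i = key l N j -> i = j) ->
  (forall i, (i < t)%N -> chain_at (mxA P) (mxB P) l X v i) ->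
  (forall i, (i < t)%N -> cochain_at (mxA P) (mxB P) l X f i) ->
  (if cyc then v t = v 0 else mxB P *m v 0 = 0) ->
  (if cyc then f t = f 0 else f 0 *m mxA P = 0) ->
  (forall i, (i < t)%N -> f i *m v i = 1%:M) ->
  exists P', annihilating P' /\ isomorphic P (mxdsum Q P').
Proof.
move=> fQ aP aQ kinj hv hf cv cf fv.
have [ha aE] := frame_hom fQ aQ aP hv cv; have [hb bE] := frame_cohom fQ aQ aP
  hf cf.
set a := \sum_(i < t) _ in ha aE; set b := \sum_(i < t) _ in hb bE.
have hc := mxhomM ha hb.
have d1 i : (i < t)%N -> E' i *m (b *m a) *m E i = 1%:M.
  by move=> lti; rewrite !mulmxA bE // -mulmxA aE // fv.
have t0 := frame_gt0 fQ.
have u : b *m a \in unitmx.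
  apply: (frame_end_unit fQ aQ kinj hc) => [i lti|]; rewrite ?d1 //.
  exact: unitmx1.
have hi : mxhom Q Q (invmx (b *m a)).
  by apply: (mxhom_inv hc); split; rewrite ?mulmxV ?mulVmx.
by apply: (split_retract aP ha (mxhomM hb hi)); rewrite -mulmxA mulVmx.
Qed.

Section Strings.
Variables (F : fieldType) (n : nat) (A B : 'M[F]_n).
Hypothesis AB0 : A *m B = 0.
Local Notation one := (fun=> 1%:M).

Lemma paired_chains u (S T : 'M[F]_n) k (f : 'M_(k, n)) (v : 'M_(n, k)) :
  (f <= pre A B u S)%MS -> pre A B u T *m v = 0 -> f *m v = 1%:M ->
  exists g h,
    [/\ [/\ g 0%N = f, (g (size u) <= S)%MS &
         forall i, (i < size u)%N -> cochain_at A B (path_letter u) one g i],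
        [/\ h 0%N = v, T *m h (size u) = 0 &
         forall i, (i < size u)%N -> chain_at A B (path_letter u) one h i] &
        forall i, (i <= size u)%N -> g i *m h i = 1%:M].
Proof.
move=> /pre_cochain[g [g0 gS gc]] /pre_chain[h [h0 hT hc]] fv.
exists g, h; split=> // i lei; rewrite -fv -g0 -h0.
apply: (pairing_const _ gc hc lei) => j ltj.
by rewrite /path_letter ltj.
Qed.

(** Vectors at vertices with distinct words are linearly independent. *)
Lemma repeated_key (f : nat -> 'rV[F]_n) (v : nat -> 'cV[F]_n) l N :
  (forall i m, (i <= n)%N -> (m < N)%N -> cochain_at A B l one f (i + m)) ->
  (forall i m, (i <= n)%N -> (m < N)%N -> chain_at A B l one v (i + m)) ->
  (forall i, (i <= n)%N -> f i *m v i = 1%:M) ->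
  exists i j, [/\ (i < j)%N, (j <= n)%N & key l N i = key l N j].
Proof.
move=> hf hv fv; apply: NNPP => none.
(* With distinct keys the Gram matrix of [n.+1] covectors and vectors would be invertible, though it
   factors through dimension [n]. *)
pose Rf : 'M[F]_(n.+1, n) := \matrix_(i < n.+1) f i.
pose Cv : 'M[F]_(n, n.+1) := \matrix_(i < n, j < n.+1) v j i 0.
have ltnn1 i : (i < n.+1)%N -> (i <= n)%N by [].
have cE i j : (i < n.+1)%N -> (j < n.+1)%N ->
    delta_mx 0 (inord i) *m (Rf *m Cv) *m delta_mx (inord j) 0 = f i *m v j.
  move=> lti ltj; rewrite mulmxA -rowE rowK inordK // -mulmxA -colE;
    congr (_ *m _).
  by apply/matrixP => a b; rewrite !mxE inordK // ord1.
have u : Rf *m Cv \in unitmx.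
  apply: (@triangular_unitmx _ _ 1 n.+1 (fun i => delta_mx (inord i) 0)
    (fun i => delta_mx 0 (inord i)) _ (key l N)).
  - apply/matrixP => a b; rewrite summxE (bigD1 a) //= big1 ?addr0 => [|i ia].
      by rewrite mul_delta_mx !mxE inord_val eqxx /= eq_sym.
    by rewrite mul_delta_mx !mxE inord_val eq_sym (negPf ia).
  - move=> i j lti ltj kij; case: (ltngtP i j) => // lt; case: none.
      by exists i, j.
    by exists j, i.
  - move=> i j lti ltj; rewrite cE //; apply: (@key_le _ _ _ _ AB0 _ _ _ _ one
    one) => m *.
    + by rewrite unitmx1.
    + by rewrite unitmx1.
    + by apply: hf.
    + by apply: hv.
  - by move=> i lti; rewrite cE // fv // unitmx1.
have : Rf *m (Cv *m invmx (Rf *m Cv)) = 1%:M by rewrite mulmxA mulmxV.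
by move/mulmx1_min; rewrite ltnn.
Qed.

(** A pairing witnessing this stops on both sides: [f *m A = 0] and [f] starts a cochain ending in
    [kermx B], [B *m v = 0] and [v] starts a chain whose end is killed by [A]. *)
Definition splits_path u := ~~ (pre A B u (kermx B) :&: kermx A <= pre A B u A
  + B)%MS.

Lemma exists_splits_path : ~~ (kermx B <= A)%MS -> exists u, splits_path u.
Proof.
move=> nBA; have AkB : (A <= kermx B)%MS by apply/sub_kermxP.
have grow N : (exists u, splits_path u) \/
    exists u, size u = N /\ ~~ (pre A B u (kermx B) <= pre A B u A)%MS.
  elim: N => [|m [[u pu]|[u [su nu]]]].
  - by right; exists [::].
  - by left; exists u.
  have [sp|nO|nD] := extend_left A B (pre_mono A B u AkB) nu.
  - by left; exists u.
  - by right; exists (Ordinary :: u); rewrite /= su.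
  - by right; exists (Double :: u); rewrite /= su.
(* A word of length [n] is too long, since its [n.+1] vertices lie at different distances from its
   end. *)
have [//|[u [su nu]]] := grow n.
have [f [v [fS Tv fv]]] := sub_pairing nu.
have [g [h [[_ gS gc] [_ hT hc] gh]]] := paired_chains fS Tv fv.
rewrite su in gS hT gc hc gh.
(* Both families are continued by zero, which satisfies the conditions at [None]. *)
have [|||i [j [ij lej]]] := @repeated_key (fun i => if (i <= n)%N then g i else
  0)
  (fun i => if (i <= n)%N then h i else 0) (path_letter u) n.+1.
- move=> i m _ _; rewrite /cochain_at; move: (i + m)%N => r.
  have := gc r; rewrite /cochain_at /path_letter su.
  case: (ltngtP r n) => [lt|gt|->] //; [exact|by rewrite mul0mx|].
  by move=> _; apply/sub_kermxP.
- move=> i m _ _; rewrite /chain_at; move: (i + m)%N => r.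
  have := hc r; rewrite /chain_at /path_letter su.
  by case: (ltngtP r n) => [lt|gt|->] //; [exact|rewrite mulmx0].
- by move=> i lei; rewrite lei gh.
move/key_path_inj; rewrite su => /(_ (ltnSn _) (leq_trans (ltnW ij) lej) lej) e.
by rewrite e ltnn in ij.
Qed.

End Strings.

Lemma exists_path_summand (F : fieldType) (P : mxpair F) : annihilating P ->
  ~~ (kermx (mxB P) <= mxA P)%MS ->
  exists w P', annihilating P' /\ isomorphic P (mxdsum (path_mxpair F w) P').
Proof.
move=> aP /(exists_splits_path (proj1 aP))[u su].
have [f [v [fS Tv fv]]] := sub_pairing su.
move: fS; rewrite sub_capmx => /andP[fS /sub_kermxP fA].
have TC m (M : 'M_(m, _)) : (M <= pre (mxA P) (mxB P) u (mxA P) + mxB P)%MS ->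
  M *m v = 0.
  by case/submxP=> D ->; rewrite -mulmxA Tv mulmx0.
have [g [h [[g0 gS gc] [h0 hT hc] gh]]] := paired_chains fS (TC _ _ (addsmxSl _
  _)) fv.
exists u; apply: (@frame_split _ P _ _ _ _ _ _ _ _ (size u).+1 h g (path_frame
  F u)) => //.
- exact: path_annihilating.
- by move=> i j lti ltj; apply: key_path_inj.
- move=> i; rewrite ltnS leq_eqVlt => /orP[/eqP ->|/hc //].
  by rewrite /chain_at /path_letter ltnn.
- move=> i; rewrite ltnS leq_eqVlt => /orP[/eqP ->|/gc //].
  by rewrite /cochain_at /path_letter ltnn; apply/sub_kermxP.
- by rewrite h0; apply: TC; exact: addsmxSr.
- by rewrite g0.
Qed.

(** * Existence: splitting off a cycle *)

Section Exact.
Variables (F : fieldType) (n : nat) (A B : 'M[F]_n).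
Hypotheses (AB0 : A *m B = 0) (BA0 : B *m A = 0) (kBA : (kermx B <= A)%MS).
Local Notation one := (fun=> 1%:M).
Local Notation pre := (pre A B).

(** Exactness at one place fixes [\rank A] as [n - \rank B], which is also the rank condition for
    exactness at the other. *)
Lemma exact_kerA : (kermx A <= B)%MS.
Proof.
have BkA : (B <= kermx A)%MS by apply/sub_kermxP.
have AkB : (A <= kermx B)%MS by apply/sub_kermxP.
have rA : \rank A = (n - \rank B)%N.
  by rewrite -mxrank_ker; apply/eqP; rewrite eqn_leq !mxrankS.
rewrite -(geq_leqif (mxrank_leqif_sup BkA)) mxrank_ker rA subKn //.
exact: rank_leq_row.
Qed.

(** Exactness excludes the first case of [extend_left], so a pairing never stops on the left. *)
Lemma pre_extend (S T : 'M[F]_n) k : (T <= S)%MS -> ~~ (S <= T)%MS ->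
  exists u, size u = k /\ ~~ (pre u S <= pre u T)%MS.
Proof.
move=> TS nST; elim: k => [|k [u [su nu]]]; first by exists [::].
have [sp|nO|nD] := extend_left A B (pre_mono A B u TS) nu.
- case/negP: sp; apply: submx_trans (capmxSr _ _) _.
  exact: submx_trans exact_kerA (addsmxSr _ _).
- by exists (Ordinary :: u); rewrite /= su.
- by exists (Double :: u); rewrite /= su.
Qed.

(** Choosing [Ordinary] whenever possible makes a cochain determined by its
    end. *)
Lemma extreme_word k : (0 < n)%N ->
  exists u, [/\ size u = k, pre u 0 = 0 & pre u 1%:M != 0].
Proof.
move=> n0; elim: k => [|k [u [su u0 u1]]].
  exists [::]; split=> //=; apply/eqP => /(congr1 (fun M : 'M_n => M (Ordinal
    n0) (Ordinal n0))).
  by rewrite !mxE eqxx => /eqP; rewrite oner_eq0.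
have [uA|uA] := eqVneq (pre u A) 0; last first.
  exists (u ++ [:: Ordinary]); rewrite size_cat su addn1 !pre_cat; split=> //.
    by rewrite [pre [:: _] _]mul0mx u0.
  by rewrite [pre [:: _] _]mul1mx.
(* [Double] is appended only when [pre u A] is 0. As [pre [:: Double] 0] is the left kernel of [B],
   contained in [A], the cochain stays determined by its end. *)
exists (u ++ [:: Double]); rewrite size_cat su addn1 !pre_cat; split=> //.
  have le0 : (pre [:: Double] 0 <= A)%MS.
    apply: submx_trans kBA; apply/sub_kermxP/eqP.
    by rewrite -submx0 -sub_ker_coker submx_refl.
  by apply/eqP; rewrite -submx0 -[X in (_ <= X)%MS]uA pre_mono.
apply: contraNneq u1 => e; rewrite -submx0 -e; apply: pre_mono.
by rewrite /= sub_ker_coker mul1mx submx1.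
Qed.

Lemma ex_min_nat (P : nat -> Prop) :
  (exists m, P m) -> exists m, P m /\ forall r, P r -> (m <= r)%N.
Proof.
case=> m; elim/ltn_ind: m => m IH Pm.
have [[r [ltr Pr]]|none] := classic (exists r, (r < m)%N /\ P r).
  exact: IH Pr.
exists m; split=> // r Pr; rewrite leqNgt; apply/negP => ltr.
by apply: none; exists r.
Qed.

(** Prolonging [u] on the left by [n] arrows gives [n.+1] starting vertices, each followed by
    [n * n + n] letters, and two of these words agree. Comparing from the beginning of [u] loses at
    most [n] letters; the remaining [n * n] leave room for [n] periods. *)
Lemma extreme_periodic_word : (0 < n)%N ->
  exists u p, [/\ size u = (n * n + n)%N, pre u 0 = 0, pre u 1%:M != 0,
    (0 < p <= n)%N &
    forall m, (m < n * n)%N -> nth Ordinary u (m + p) = nth Ordinary u m].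
Proof.
move=> n0; have [u [su u0 u1]] := extreme_word (n * n + n) n0.
have [|w [sw nw]] := pre_extend n (pre_mono A B u (sub0mx _ 1%:M)).
  by rewrite u0 submx0.
rewrite -!pre_cat in nw; have [f [v [fS Tv fv]]] := sub_pairing nw.
have [g [h [[_ _ gc] [_ _ hc] gh]]] := paired_chains fS Tv fv.
rewrite size_cat sw su in gc hc gh.
have [|||i [j [ij lej /key_eq kE]]] := @repeated_key _ _ A B AB0 g h
    (path_letter (w ++ u)) (n * n + n).
- by move=> i m lei ltm; apply: gc; lia.
- by move=> i m lei ltm; apply: hc; lia.
- by move=> i lei; apply: gh; lia.
have yE m : (m < n * n + n)%N -> nth Ordinary (w ++ u) (i + m) = nth Ordinary
  (w ++ u) (j + m).
  move=> ltm; have : path_letter (w ++ u) (i + m) = path_letter (w ++ u) (j +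
    m).
    apply: kE => // r ltr; rewrite /path_letter size_cat sw su ifT //; lia.
  by rewrite /path_letter size_cat sw su !ifT => [[]||] //; lia.
have uE m : nth Ordinary u m = nth Ordinary (w ++ u) (n + m).
  by rewrite nth_cat sw ifF ?addKn //; lia.
exists u, (j - i)%N; split=> //; first by lia.
move=> m ltm; rewrite !uE.
have -> : (n + (m + (j - i)) = j + (n - i + m))%N by lia.
rewrite -yE; last by lia.
by congr nth; lia.
Qed.

Lemma iter_pre_decr q r s (S := 1%:M) : (r <= s)%N ->
  (iter s (pre q) S <= iter r (pre q) S)%MS.
Proof.
move/subnK <-; elim: (s - r)%N => [|m IH]; first by rewrite add0n.
apply: submx_trans IH; rewrite addSn; elim: (m + r)%N => [|a IH];
  first exact: submx1.
exact: pre_mono.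
Qed.

(** For the least period a nontrivial rotation fixing [q] would give a smaller one. Both [q] and its
    [n]-fold repetition are prefixes of [u], so [pre q 0] lies in [pre u 0], and [pre u 1%:M] in the
    [n]-th iterate. *)
Lemma extreme_cyclic_word : (0 < n)%N ->
  exists q, [/\ aperiodic q, (0 < size q)%N, pre q 0 = 0 &
                iter n (pre q) 1%:M != 0].
Proof.
move=> n0; have [u [p0 [su u0 u1 p00 per0]]] := extreme_periodic_word n0.
have [p [[pp per] minp]] := @ex_min_nat (fun p => (0 < p)%N /\
  forall m, (m < n * n)%N -> nth Ordinary u (m + p) = nth Ordinary u m)
  (ex_intro _ p0 (conj (proj1 (andP p00)) per0)).
have lepn : (p <= n)%N.
  by case/andP: p00 => p01 p02; apply: leq_trans p02; apply: minp.
set q := take p u.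
have sq : size q = p by rewrite size_take su ifT //; nia.
have uq m : (m < n * n + p)%N -> nth Ordinary u m = nth Ordinary q (m %% p).
  elim/ltn_ind: m => m IH ltm; have [lt|ge] := ltnP m p.
    by rewrite modn_small // nth_take.
  rewrite -{1}(subnK ge) per; last by lia.
  rewrite IH; [|lia|lia].
  by rewrite -[in RHS](subnK ge) modnDr.
exists q; split; last 1 first.
- have tk r : (r <= n)%N -> pre (take (r * p) u) 1%:M = iter r (pre q) 1%:M.
    elim: r => [|r IH] ler; first by rewrite mul0n take0.
    rewrite iterS -IH; last exact: ltnW.
    rewrite -pre_cat; congr (pre _ _); apply: (@eq_from_nth _ Ordinary).
      rewrite size_cat sq !size_takel ?mulSn ?su //; nia.
    move=> m; rewrite size_takel ?su => [ltm|]; last by nia.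
    rewrite nth_take // nth_cat sq; case: ltnP => ge; first by rewrite nth_take.
    rewrite nth_take; last by lia.
    rewrite -{1}(subnK ge) per //; nia.
  rewrite -tk //; apply: contraNneq u1 => e; rewrite -submx0 -e.
  by rewrite -{1}(cat_take_drop (n * p) u) pre_cat pre_mono // submx1.
- move=> i; rewrite sq => /andP[i0 ip] rq.
  have : (p <= i)%N; last by lia.
  apply: minp; split=> // m ltm; rewrite !uq; [|lia|lia].
  have rotq : rot i q = q by rewrite -{1}rq rotrK.
  rewrite -{2}rotq nth_rot_mod ?sq ?ltn_mod //.
  by rewrite modnDml.
- by rewrite sq.
- apply/eqP; rewrite -submx0 -[X in (_ <= X)%MS]u0 -[u](cat_take_drop p)
  pre_cat.
  by rewrite pre_mono ?sub0mx.
Qed.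

Lemma iter_pre_stable q : iter n (pre q) 1%:M != 0 ->
  exists r, (r <= n)%N /\ (iter r (pre q) 1%:M <= iter r.+1 (pre q) 1%:M)%MS.
Proof.
move=> nz; apply: NNPP => none; case/negP: nz; rewrite -mxrank_eq0.
have : forall r, (r <= n)%N -> (\rank (iter r (pre q) (1%:M : 'M[F]_n)) + r <=
  n)%N.
  elim=> [|r IH] ler; first by rewrite addn0 rank_leq_row.
  have := IH (ltnW ler).
  have : (iter r.+1 (pre q) 1%:M < iter r (pre q) (1%:M : 'M[F]_n))%MS.
    rewrite ltmxE iter_pre_decr //=; apply/negP => st.
    by apply: none; exists r; split=> //; exact: ltnW.
  by move/rank_ltmx; lia.
by move/(_ n (leqnn n)); lia.
Qed.

Lemma chain_atMr l k k' (v : nat -> 'M[F]_(n, k)) (c : 'M_(k, k')) i :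
  chain_at A B l one v i -> chain_at A B l one (fun i => v i *m c) i.
Proof.
rewrite /chain_at; case: (l i) => [[]|]; rewrite ?mulmx1 mulmxA => -> //.
by rewrite mul0mx.
Qed.

Lemma chain_atD l k (v w : nat -> 'M[F]_(n, k)) i :
  chain_at A B l one v i -> chain_at A B l one w i ->
  chain_at A B l one (fun i => v i + w i) i.
Proof.
rewrite /chain_at; case: (l i) => [[]|]; rewrite ?mulmx1 mulmxDr => -> -> //.
by rewrite addr0.
Qed.

Lemma cochain_atMl l k k' (f : nat -> 'M[F]_(k, n)) (c : 'M_(k', k)) i :
  cochain_at A B l one f i -> cochain_at A B l one (fun i => c *m f i) i.
Proof.
rewrite /cochain_at; case: (l i) => [[]|]; rewrite ?mul1mx -mulmxA => -> //.
by rewrite mulmx0.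
Qed.

(** A chain starting at the identity matrix is a linear choice of chains; it
    can be made compatible with the filtration by the [iter s (pre q) 1]. *)
Lemma filtered_chain q r : pre q 0 = 0 ->
  exists h : nat -> 'M[F]_n, [/\ h 0%N = 1%:M,
    forall i, (i < size q)%N -> chain_at A B (path_letter q) one h i &
    forall s (v : 'M_n), (s < r)%N -> iter s.+1 (pre q) 1%:M *m v = 0 ->
      iter s (pre q) 1%:M *m (h (size q) *m v) = 0].
Proof.
move=> q0; pose Q s : 'M[F]_n := iter s (pre q) 1%:M.
have Qle s s' m (v : 'M_(n, m)) : (s <= s')%N -> Q s *m v = 0 -> Q s' *m v = 0.
  move=> les Qv; have /submxP[D e] : (Q s' <= Q s)%MS by exact: iter_pre_decr.
  by rewrite e -mulmxA Qv mulmx0.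
elim: r => [|r [h [h0 hc hQ]]].
  have [|h [h0 _ hc]] := @pre_chain _ _ A B q 0 _ 1%:M;
    first by rewrite q0 mul0mx.
  by exists h.
(* A projection whose kernel on column vectors is the annihilator of [Q s]. *)
pose e s : 'M[F]_n := pinvmx (Q s) *m Q s.
have Qe s : Q s *m (1%:M - e s) = 0.
  by rewrite mulmxBr mulmx1 mulmxA mulmxKpV ?submx_refl // subrr.
have ev s m (v : 'M_(n, m)) : Q s *m v = 0 -> e s *m v = 0.
  by move=> Qv; rewrite -mulmxA Qv mulmx0.
have [z [z0 Qz zc]] := @pre_chain _ _ A B q (Q r) _ _ (Qe r.+1).
(* The old choice is kept on the annihilator of [Q r]. On the image of [e r] it is kept only after
   [e r.+1]; the remainder, annihilated by [Q r.+1], follows [z], which ends in the annihilator of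
   [Q r]. *)
exists (fun i => h i *m (1%:M - e r) + (h i *m e r.+1 + z i) *m e r); split.
- by rewrite h0 z0 !mul1mx (addrC (e r.+1)) subrK mul1mx subrK.
- move=> i lti; apply: chain_atD; first by apply: chain_atMr; exact: hc.
  by apply: chain_atMr; apply: chain_atD (zc i lti); apply: chain_atMr;
    exact: hc.
move=> s v les Qv; set hq := h (size q); set zq := z (size q).
have -> : (hq *m (1%:M - e r) + (hq *m e r.+1 + zq) *m e r) *m v =
    hq *m ((1%:M - e r) *m v) + (hq *m e r.+1 + zq) *m (e r *m v).
  by rewrite mulmxDl -!mulmxA.
move: les Qv; rewrite ltnS leq_eqVlt => /orP[/eqP -> | lts] Qv; last first.
  have er : e r *m v = 0 by apply/ev/(Qle s.+1).
  by rewrite er mulmx0 addr0 mulmxBl mul1mx er subr0 hQ.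
have Qv1 : Q r *m ((1%:M - e r) *m v) = 0 by rewrite mulmxA Qe mul0mx.
have Qv2 : Q r.+1 *m (e r *m v) = 0.
  have -> : e r *m v = v - (1%:M - e r) *m v by rewrite mulmxBl mul1mx opprB
    addrC subrK.
  by rewrite mulmxBr Qv (Qle r) // subrr.
rewrite [(_ + zq) *m _]mulmxDl -(mulmxA hq) (ev r.+1) // mulmx0 add0r mulmxDr.
rewrite (mulmxA _ zq) [_ *m zq]Qz mul0mx addr0.
move: hQ Qv1; case: (r) => [|r'] hQ Qv1.
  by rewrite mul1mx in Qv1; rewrite Qv1 !mulmx0.
by apply: (Qle r' r'.+1) => //; apply: hQ.
Qed.

(** One period acts on the stable row space [Q r], with basis [U], by the invertible [T]. On
    vectors, the endpoint map [G] of a linear choice of chains acts as [invmx T] modulo the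
    annihilator of [U]. The filtration makes [G] nilpotent on this annihilator, so, as in Fitting's
    lemma, the image of [Gr r] is a complement to it, paired perfectly with [U]. *)
Lemma exists_closed_chain : (0 < n)%N ->
  exists q k (f : nat -> 'M[F]_(k, n)) (v : nat -> 'M[F]_(n, k)) (T : 'M[F]_k),
  [/\ [/\ aperiodic q, (0 < size q)%N, (0 < k)%N & T \in unitmx],
      forall i, (i < size q)%N -> cochain_at A B (path_letter q) one f i,
      forall i, (i < size q)%N -> chain_at A B (path_letter q) one v i,
      f (size q) = T *m f 0%N /\ v (size q) = v 0%N *m invmx T &
      forall i, (i <= size q)%N -> f i *m v i = 1%:M].
Proof.
move=> n0; have [q [aq q0 pq0 nz]] := extreme_cyclic_word n0.
have [r [lern st]] := iter_pre_stable nz.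
have [h [h0 hc hQ]] := filtered_chain r pq0.
pose Q s : 'M[F]_n := iter s (pre q) 1%:M.
have [k [U [k0 freeU UQ QU]]] : exists k (U : 'M[F]_(k, n)),
    [/\ (0 < k)%N, row_free U, (U <= Q r)%MS & (Q r <= U)%MS].
  exists (\rank (Q r)), (row_base (Q r)).
  rewrite !eq_row_base row_base_free submx_refl; split=> //.
  rewrite lt0n mxrank_eq0; apply: contraNneq nz => e.
  by rewrite -submx0 -e iter_pre_decr.
have [f [f0 fU fc]] : exists f, [/\ f 0%N = U, (f (size q) <= U)%MS &
    forall i, (i < size q)%N -> cochain_at A B (path_letter q) one f i].
  have [|f [f0 fU fc]] := @pre_cochain _ _ A B q (Q r) _ U.
    exact: submx_trans UQ st.
  by exists f; split=> //; exact: submx_trans fU QU.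
have [T fT] := submxP fU.
(* If [c *m T = 0], the cochain [c *m f i] ends at 0, so by [pre q 0 = 0] it starts at 0. *)
have uT : T \in unitmx.
  rewrite -row_free_unit; apply: inj_row_free => c cT.
  have : (c *m f 0%N <= pre q 0)%MS.
    apply: (@cochain_pre _ _ A B q 0 _ (fun i => c *m f i));
      first by rewrite fT mulmxA cT mul0mx sub0mx.
    by move=> i lti; apply: cochain_atMl; exact: fc.
  rewrite pq0 submx0 f0 => /eqP cU; apply: (row_free_inj freeU).
  by rewrite cU mul0mx.
have lN i : (i < size q)%N -> path_letter q i <> None by rewrite /path_letter
  => ->.
pose G := h (size q).
have UG : U *m G = invmx T *m U.
  have := pairing_const lN fc hc (leqnn _); rewrite fT f0 h0 mulmx1 => e.
  by rewrite -[in RHS]e -!mulmxA mulKmx.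
pose Gr s := iter s (mulmx G) (1%:M : 'M[F]_n).
have GrC s : G *m Gr s = Gr s *m G.
  by elim: s => [|s IH]; rewrite ?mulmx1 ?mul1mx // [Gr _]iterS -!mulmxA -IH
    mulmxA.
have Gr0 s (v : 'M_n) : (s <= r)%N -> Q s *m v = 0 -> Gr s *m v = 0.
  elim: s v => [|s IH] v les Qv; first by rewrite mul1mx; rewrite mul1mx in Qv.
  by rewrite [Gr _]iterS -/(Gr _) GrC -mulmxA IH ?hQ //; exact: ltnW.
pose E := pinvmx U; have UE : U *m E = 1%:M by exact: mulmxVp.
have GrE : Gr r *m E *m U = Gr r.
  apply/eqP; rewrite -subr_eq0 -mulmxA -[X in _ - X]mulmx1 -mulmxBr Gr0 //.
  have [D QD] := submxP QU.
  by rewrite QD mulmxBr mulmx1 mulmxA -(mulmxA D U E) UE mulmx1 subrr.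
(* [Z] is a power of [invmx T]; it later normalizes the pairing to 1. *)
have [Z uZ UZ] : exists2 Z, Z \in unitmx & U *m Gr r = Z *m U.
  elim: (r) => [|s [Z uZ e]]; first by exists 1%:M; rewrite ?unitmx1 ?mulmx1
    ?mul1mx.
  exists (Z *m invmx T); first by rewrite unitmx_mul uZ unitmx_inv.
  by rewrite [Gr _]iterS -/(Gr _) GrC mulmxA e -(mulmxA Z U) UG mulmxA.
pose W := Gr r *m E.
have UW : U *m W = Z by rewrite mulmxA UZ -mulmxA UE mulmx1.
have GW : G *m W = W *m invmx T.
  rewrite mulmxA GrC -{1}GrE -!mulmxA (mulmxA U G) UG -!mulmxA UE mulmx1.
  by rewrite !mulmxA.
have ZT : Z *m invmx T = invmx T *m Z.
  by rewrite -UW -mulmxA -GW mulmxA UG -mulmxA.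
have ZT' : invmx T *m invmx Z = invmx Z *m invmx T.
  by rewrite -[LHS](mulKmx uZ) (mulmxA Z) ZT mulmxK.
exists q, k, f, (fun i => h i *m (W *m invmx Z)), T.
have hc' i : (i < size q)%N -> chain_at A B (path_letter q) one (fun i => h i
  *m (W *m invmx Z)) i.
  by move=> lti; apply: chain_atMr; exact: hc.
split=> //.
- by rewrite fT f0 h0 mul1mx mulmxA -/G GW -!mulmxA ZT'.
- move=> i lei; rewrite (pairing_const lN fc hc' lei) f0 h0 mul1mx mulmxA UW.
  by rewrite mulmxV.
Qed.

End Exact.

(** * Splitting off a Frobenius block *)

Section FrobeniusSummand.
Variable F : fieldType.

Lemma irreducible_factor (q : {poly F}) : (1 < size q)%N ->
  exists p, [/\ irreducible_poly p, p \is monic & p %| q].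
Proof.
have [m] := ubnP (size q); elim: m q => // m IH q; rewrite ltnS => leq_m q1.
have q0 : q != 0 by rewrite -size_poly_gt0 ltnW.
have [irr|red] := classic (irreducible_poly q).
  have lq : lead_coef q != 0 by rewrite lead_coef_eq0.
  have eqq : (lead_coef q)^-1 *: q %= q by rewrite eqp_scale ?invr_neq0.
  exists ((lead_coef q)^-1 *: q); split; last by rewrite (eqp_dvdl _ eqq).
    split=> [|d d1]; first by rewrite (eqp_size eqq).
    rewrite (eqp_dvdr _ eqq) => /(apply_irredp irr d1) dq.
    by rewrite (eqp_trans dq) // eqp_sym.
  by rewrite monicE lead_coefZ mulVf.
have [d [d1 dq ndq]] : exists d : {poly F}, [/\ size d != 1%N,
  d %| q & ~~ (d %= q)].
  apply: NNPP => none; apply: red; split=> // d d1 dq.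
  by apply: contra_notT none => ndq; exists d.
have d0 : d != 0 by apply: contraTneq dq => ->; rewrite dvd0p.
have ltd : (size d < size q)%N.
  by rewrite ltn_neqAle dvdp_leq // andbT; apply: contra ndq => s;
    rewrite -dvdp_size_eqp.
have [||p [ip mp pd]] := IH d; first by lia.
  by move: d1; rewrite -size_poly_gt0 in d0; lia.
by exists p; split=> //; exact: dvdp_trans pd dq.
Qed.

Lemma irreducible_multiplicity (p q : {poly F}) : irreducible_poly p -> q != 0
  ->
  exists l s, q = p ^+ l * s /\ ~~ (p %| s).
Proof.
move=> [p1 _]; have [m] := ubnP (size q).
elim: m q => // m IH q; rewrite ltnS => leq_m q0.
have [/dvdpP[r qr]|npq] := boolP (p %| q); last by exists 0%N, q;
  rewrite expr0 mul1r.
have r0 : r != 0 by apply: contraNneq q0 => r0; rewrite qr r0 mul0r.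
have p0 : p != 0 by rewrite -size_poly_gt0 ltnW.
have [|l [s [rs ps]]] := IH r _ r0.
  have sq : size q = (size r + size p).-1 by rewrite qr size_mul.
  have p2 : (1 < size p)%N := p1.
  by move: leq_m; rewrite sq; lia.
by exists l.+1, s; split=> //; rewrite qr rs exprS mulrC mulrA.
Qed.

Lemma horner_mx_coef n (Y : 'M[F]_n.+1) (h : {poly F}) m : (size h <= m)%N ->
  horner_mx Y h = \sum_(i < m) h`_i *: Y ^+ i.
Proof.
move=> leh; have {1}-> : h = \poly_(i < m) h`_i.
  apply/polyP => i; rewrite coef_poly; case: ltnP => // ge.
  by rewrite nth_default // (leq_trans leh).
rewrite poly_def rmorph_sum /=; apply: eq_bigr => i _.
by rewrite horner_mxZ rmorphXn /= horner_mx_X.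
Qed.

Definition frobenius_mx (d : {poly F}) k : 'M[F]_k :=
  \matrix_(i, j) if j.+1 == k then - d`_i else (i == j.+1 :> nat)%:R.

(** Stated in a module, to serve both the columns [Y ^+ m *m v1] and the rows [f1 *m Y ^+ m]. *)
Lemma frobenius_mx_sum (V : lmodType F) (d : {poly F}) k (x : nat -> V) (c :
  'I_k) :
  x k = \sum_(i < k) - d`_i *: x i ->
  \sum_(i < k) frobenius_mx d k i c *: x i = x c.+1.
Proof.
move=> xk; have [ck|nck] := eqVneq c.+1 k.
  by rewrite ck xk; apply: eq_bigr => i _; rewrite mxE ck eqxx.
have ltc : (c.+1 < k)%N by rewrite ltn_neqAle nck /=.
rewrite (bigD1 (Ordinal ltc)) //= big1 ?addr0 => [|i ic];
  rewrite mxE (negPf nck).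
  by rewrite eqxx scale1r.
by rewrite -val_eqE /= in ic; rewrite (negPf ic) scale0r.
Qed.

Lemma frobenius_summand n (Y : 'M[F]_n) : (0 < n)%N ->
  exists k (Phi : 'M[F]_k) (a : 'M_(k, n)) (b : 'M_(n, k)),
    [/\ frobenius_block Phi, a *m b = 1%:M, a *m Y = Phi *m a & Y *m b = b *m
      Phi].
Proof.
case: n Y => // n Y _.
have q1 : (1 < size (mxminpoly Y))%N by rewrite size_mxminpoly ltnS
  mxminpoly_nonconstant.
have [p [ip mp pq]] := irreducible_factor q1.
have p0 := irredp_neq0 ip.
have [l [s [qE nps]]] := irreducible_multiplicity ip (monic_neq0
  (mxminpoly_monic Y)).
have l0 : (0 < l)%N.
  by case: l qE => // qE; move: nps; rewrite -[s]mul1r -[1](expr0 p) -qE pq.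
have s0 : s != 0 by apply: contraNneq nps => ->; rewrite dvdp0.
(* As [p] does not divide [s], this polynomial is no multiple of [p ^+ l * s]. One factor [s] goes
   into [f1], the other into [v1], so that [p ^+ l] kills both. *)
have [u [w nz]] : exists u w, horner_mx Y (p ^+ l.-1 * s * s) u w != 0.
  apply: NNPP => none; case/negP: nps.
  have : mxminpoly Y %| p ^+ l.-1 * s * s.
    apply: mxminpoly_min; apply/matrixP => u w; rewrite [RHS]mxE; apply/eqP.
    by apply: contra_notT none => nz; exists u, w.
  rewrite qE dvdp_mul2r // -{1}(prednK l0) exprS mulrC [p ^+ _ * s]mulrC.
  by rewrite mulrC dvdp_mul2r // expf_neq0.
pose hm h := horner_mx Y h.
have hmM g h : hm (g * h) = hm g *m hm h by rewrite /hm rmorphM.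
have hmD g h : hm (g + h) = hm g + hm h by rewrite /hm rmorphD.
pose f1 : 'rV_n.+1 := delta_mx 0 u *m hm s; pose v1 : 'cV_n.+1 := hm s *m
  delta_mx w 0.
pose d := p ^+ l; pose k := (size d).-1.
have d0 : d != 0 by rewrite expf_neq0.
have sd : size d = k.+1 by rewrite prednK // size_poly_gt0.
have md : d \is monic by rewrite monic_exp.
have q0 : hm (d * s) = 0 by rewrite -qE; exact: mx_root_minpoly.
have fd : f1 *m hm d = 0 by rewrite -mulmxA -hmM mulrC q0 mulmx0.
have dv : hm d *m v1 = 0 by rewrite mulmxA -hmM q0 mul0mx.
have Yd : Y ^+ k = \sum_(i < k) - d`_i *: Y ^+ i + hm d.
  rewrite /hm (@horner_mx_coef _ _ _ k.+1) ?sd // big_ord_recr /=.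
  have -> : d`_k = 1 by move/monicP: md; rewrite /lead_coef sd.
  rewrite scale1r addrA -big_split /= big1 ?add0r // => i _.
  by rewrite scaleNr addNr.
pose b : 'M[F]_(n.+1, k) := \matrix_(i, c) (Y ^+ c *m v1) i 0.
pose a0 : 'M[F]_(k, n.+1) := \matrix_(r < k) (f1 *m Y ^+ r).
pose Phi := frobenius_mx d k.
have Yb : Y *m b = b *m Phi.
  apply/matrixP => i c; rewrite [RHS]mxE.
  have -> : (Y *m b) i c = (Y ^+ c.+1 *m v1) i 0.
    by rewrite exprS -mulmxA [LHS]mxE [RHS]mxE; apply: eq_bigr => j _;
      rewrite [b _ _]mxE.
  rewrite -(@frobenius_mx_sum _ d k (fun m => Y ^+ m *m v1) c).
    by rewrite summxE; apply: eq_bigr => j _; rewrite mxE [b _ _]mxE mulrC.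
  by rewrite Yd mulmxDl dv addr0 mulmx_suml; apply: eq_bigr => j _;
    rewrite scalemxAl.
have aY : a0 *m Y = Phi^T *m a0.
  apply/row_matrixP => r; rewrite row_mul rowK row_mul -mulmxA.
  rewrite (_ : Y ^+ r *m Y = Y ^+ r.+1); last by rewrite exprSr.
  rewrite -(@frobenius_mx_sum _ d k (fun m => f1 *m Y ^+ m) r).
    rewrite mulmx_sum_row; apply: eq_bigr => j _; by rewrite rowK !mxE.
  by rewrite Yd mulmxDr fd addr0 mulmx_sumr; apply: eq_bigr => j _;
    rewrite scalemxAr.
have nz1 : f1 *m hm (p ^+ l.-1) *m v1 != 0.
  have e : f1 *m hm (p ^+ l.-1) *m v1 = delta_mx 0 u *m hm (p ^+ l.-1 * s * s)
    *m delta_mx w 0.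
    have c : hm s *m hm (p ^+ l.-1) = hm (p ^+ l.-1) *m hm s by rewrite -!hmM
      mulrC.
    by rewrite !hmM !mulmxA -(mulmxA _ (hm s) (hm (p ^+ l.-1))) c !mulmxA.
  apply: contraNneq nz => z; move: e; rewrite z -rowE -colE => /matrixP/(_ 0 0).
  by rewrite [LHS]mxE [RHS]mxE [RHS]mxE => <-.
(* This is the Hankel matrix of the values [f1 *m Y ^+ (r + c) *m v1]. A row killing it is a
   polynomial [g] of size at most [k] with [f1 *m hm (g * h) *m v1 = 0] for all [h]. If [g] is
   nonzero, the ideal of [g] and [d] contains [p ^+ l.-1], against [nz1]. *)
have uH : a0 *m b \in unitmx.
  rewrite -row_free_unit; apply: inj_row_free => z zH.
  pose g := \poly_(i < k) (if insub i is Some j then z 0 j else 0).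
  have gE (i : 'I_k) : g`_i = z 0 i by rewrite coef_poly ltn_ord valK.
  have zg : z *m a0 = f1 *m hm g.
    rewrite /hm (@horner_mx_coef _ _ _ k) ?size_poly // mulmx_sumr
      mulmx_sum_row.
    by apply: eq_bigr => i _; rewrite rowK gE scalemxAr.
  have gc h : f1 *m hm g *m hm h *m v1 = 0.
    rewrite -(mulmxA _ (hm h)); have -> : hm h *m v1 = hm (h %% d) *m v1.
      rewrite {1}(divp_eq h d) /hm rmorphD /= -/(hm _) -/(hm _) hmM mulmxDl
        -mulmxA dv.
      by rewrite mulmx0 add0r.
    have szr : (size (h %% d)%R <= k)%N by rewrite -ltnS -sd ltn_modp.
    have -> : hm (h %% d) *m v1 = b *m \col_c (h %% d)`_c.
      rewrite /hm (horner_mx_coef Y szr) mulmx_suml; apply/matrixP => i j.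
      rewrite summxE [RHS]mxE; apply: eq_bigr => c _.
      by rewrite -scalemxAl !ord1 [LHS]mxE [b _ _]mxE [X in _ = _ * X]mxE mulrC.
    by rewrite mulmxA -zg -(mulmxA z) zH mul0mx.
  have [g0|gn] := eqVneq g 0.
    by apply/rowP => i; rewrite -gE g0 coef0 mxE.
  have [m [g' [gE' npg]]] := irreducible_multiplicity ip gn.
  have ltml : (m < l)%N.
    rewrite ltnNge; apply/negP => leml.
    have : p ^+ m %| g by rewrite gE' dvdp_mulr.
    move/(dvdp_leq gn)/leq_trans/(_ (size_poly _ _)) => lek.
    have : ((size p).-1 * m < (size p).-1 * l)%N.
      by rewrite -!size_exp -/d -/k prednK // size_poly_gt0 expf_neq0.
    by rewrite ltnNge leq_mul2l leml orbT.
  have /(coprimep_expl l)/Bezout_eq1_coprimepP[[x y] /= xy] : coprimep p g'.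
    by rewrite irreducible_poly_coprime.
  have pE : p ^+ l.-1 = p ^+ l.-1 * x * d + g * (y * p ^+ (l.-1 - m)).
    have lE : p ^+ l.-1 = p ^+ (l.-1 - m) * p ^+ m by rewrite -exprD subnK //
      -ltnS prednK.
    rewrite -[LHS]mulr1 -xy mulrDr -/d mulrA; congr (_ + _).
      by rewrite mulrA.
    by rewrite gE' {1}lE mulrACA mulrC (mulrC _ y) mulrA.
  case/eqP: nz1; rewrite pE hmD (hmM _ d) (hmM g) mulmxDr mulmxDl.
  rewrite (mulmxA f1 (hm g)) gc addr0 (mulmxA f1 _ (hm d)).
  by rewrite -(mulmxA _ (hm d)) dv mulmx0.
(* The rows of [a0] carry [Phi^T]; the Hankel matrix intertwines it with [Phi], and its inverse also
   normalizes the pairing with [b]. *)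
pose a := invmx (a0 *m b) *m a0.
have HP : (a0 *m b) *m Phi = Phi^T *m (a0 *m b) by rewrite -mulmxA -Yb !mulmxA
  aY.
exists k, Phi, a, b; split=> //.
- by exists p, l; split.
- by rewrite -mulmxA mulVmx.
- rewrite -mulmxA aY !mulmxA; congr (_ *m _).
  by rewrite -[LHS](mulmxK uH) -(mulmxA _ Phi^T) -HP mulKmx.
Qed.

End FrobeniusSummand.

(** * Existence of a decomposition *)

Section Existence.
Variable F : fieldType.

Lemma exists_cycle_summand (P : mxpair F) : annihilating P ->
  (kermx (mxB P) <= mxA P)%MS -> (0 < mxsize P)%N ->
  exists w m k (Phi : 'M[F]_k) P', [/\ wf_summand (Cycle w m Phi),
    annihilating P' & isomorphic P (mxdsum (cycle_mxpair w m Phi) P')].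
Proof.
move=> aP kBA n0.
have [q [k [f [v [T [[aq q0 k0 uT] fc vc [fT vT] fv]]]]]] :=
  exists_closed_chain (proj1 aP) (proj2 aP) kBA n0.
have [m ltm dm] : exists2 m, (m < size q)%N & (exists i,
  double_at q i) -> double_at q m.
  have [[i di]|nd] := classic (exists i, double_at q i); last by exists 0%N.
  exists i => //; move: di; rewrite /double_at; case: ltnP => // ?.
  by rewrite nth_default.
(* The whole holonomy of the cycle is put on the arrow [m]; its direction decides between [T] and
   the inverse. *)
pose Y := if double_at q m then T else invmx T.
have uY : Y \in unitmx by rewrite /Y; case: ifP; rewrite ?unitmx_inv.
have [k' [Phi [a [b [fPhi ab aY Yb]]]]] := frobenius_summand Y k0.
have uPhi : Phi \in unitmx.
  have : Phi *m (a *m invmx Y *m b) = 1%:M.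
    by rewrite !mulmxA -aY mulmxK.
  by case/mulmx1_unit.
(* Rescaling by [T] after [m] closes the chain, since [v (size q) *m T = v 0]; then [b] and [a] cut
   down to one Frobenius block. *)
pose v' i := (if (i <= m)%N then v i else v i *m T) *m b.
pose f' i := a *m (if (i <= m)%N then f i else invmx T *m f i).
have letE i : (i < size q)%N ->
    cycle_letter q i = Some (if double_at q i then Double else Ordinary) /\
    path_letter q i = Some (if double_at q i then Double else Ordinary).
  by move=> lti; rewrite /cycle_letter /path_letter modn_small // lti
    double_at_nth.
exists q, m, k', Phi.
have [||||||P' [aP' iP']] := @frame_split _ P _ _ _ _ _ _ _ _ (size q).*2 v' f'
    (cycle_frame m q0 uPhi) aP (cycle_annihilating q m Phi).
- by move=> i j; apply: key_cycle_inj.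
- move=> i lti; have := vc i lti; have [cl pl] := letE i lti.
  rewrite /chain_at cl pl /v' /cycle_weight modn_small //.
  have [->|im] := eqVneq i m.
    move: Yb; rewrite leqnn ltnn /Y; case: (double_at q m) => Yb e;
      rewrite mulmx1 in e.
      by rewrite -[RHS]mulmxA -Yb !mulmxA e.
    by rewrite -[RHS]mulmxA -Yb !mulmxA e mulmxK.
  have -> : (i.+1 <= m)%N = (i <= m)%N by lia.
  by case: (i <= m)%N; case: (double_at q i); rewrite !mulmx1 => e;
    rewrite !mulmxA e.
- move=> i lti; have := fc i lti; have [cl pl] := letE i lti.
  rewrite /cochain_at cl pl /f' /cycle_weight modn_small //.
  have [->|im] := eqVneq i m.
    move: aY; rewrite leqnn ltnn /Y; case: (double_at q m) => aY e;
      rewrite mul1mx in e.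
      by rewrite mulmxA -aY -!mulmxA e mulKVmx.
    by rewrite mulmxA -aY -!mulmxA e.
  have -> : (i.+1 <= m)%N = (i <= m)%N by lia.
  by case: (i <= m)%N; case: (double_at q i); rewrite !mul1mx => e;
    rewrite -!mulmxA e.
- by rewrite /v' leqNgt ltm /= vT mulmxKV.
- by rewrite /f' leqNgt ltm /= fT mulKmx.
- move=> i lti; rewrite /f' /v'; case: ifP => _.
    by rewrite mulmxA -(mulmxA a) fv ?mulmx1 // ltnW.
  rewrite !mulmxA -(mulmxA _ (f i)) fv; last exact: ltnW.
  by rewrite mulmx1 mulmxKV.
by exists P'; split.
Qed.

Lemma exists_sum (P : mxpair F) : annihilating P ->
  exists s, wf_sum s /\ isomorphic P (mxsum s).
Proof.
have [N] := ubnP (mxsize P); elim: N P => // N IH P; rewrite ltnS => leN aP.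
have [P0|Pn0] := eqVneq (mxsize P) 0%N.
  exists [::]; split; first by constructor.
  case: P P0 {leN aP} => n A B /= n0; subst n; rewrite (flatmx0 A) (flatmx0 B).
  exact: isomorphic_refl.
have next x P' : wf_summand x -> annihilating P' ->
    isomorphic P (mxdsum (mx_of_summand x) P') ->
    exists s, wf_sum s /\ isomorphic P (mxsum s).
  move=> wx aP' iP; have sP : mxsize P = (mxsize (mx_of_summand x) + mxsize
    P')%N.
    by case: iP => c [d [_ _ /mulmx1_eq_size]].
  have [|s [ws is_]] := IH P' _ aP'; first by have := summand_size_gt0 wx; lia.
  exists (x :: s); split; first by constructor.
  apply: isomorphic_trans iP _.
  by apply: isomorphic_dsum is_; exact: isomorphic_refl.
have [kBA|nkBA] := boolP (kermx (mxB P) <= mxA P)%MS.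
  have [|w [m [k [Phi [P' [wx aP' iP]]]]]] := exists_cycle_summand aP kBA;
    first by lia.
  exact: next wx aP' iP.
have [w [P' [aP' iP]]] := exists_path_summand aP nkBA.
exact: (next (Path F w) P').
Qed.

Lemma decomposition_unique (P : mxpair F) s s' :
  wf_sum s -> isomorphic P (mxsum s) ->
  (wf_sum s' /\ isomorphic P (mxsum s')) <-> sum_equiv s s'.
Proof.
move=> ws iPs; split=> [[ws' iPs']|e].
  apply: isomorphic_sum_equiv => //.
  exact: isomorphic_trans (isomorphic_sym iPs) iPs'.
split; first exact: sum_equiv_wf ws.
exact: isomorphic_trans iPs (sum_equiv_iso ws e).
Qed.

End Existence.

(** * Operators versus matrices *)

Section Operators.
Variable F : fieldType.
Implicit Types P Q R : oppair F.

Lemma opisomorphic_trans P Q R :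
  opisomorphic P Q -> opisomorphic Q R -> opisomorphic P R.
Proof.
move=> [f [bf fA fB]] [g [bg gA gB]]; exists (g \o f)%VF; split.
- by apply: eq_bij (bij_comp bg bf) _ _ => x; rewrite lfunE.
- by rewrite -comp_lfunA fA comp_lfunA gA comp_lfunA.
- by rewrite -comp_lfunA fB comp_lfunA gB comp_lfunA.
Qed.

Lemma opisomorphic_refl P : opisomorphic P P.
Proof.
exists \1%VF; split; rewrite ?comp_lfun1l ?comp_lfun1r //.
by exists id => x; rewrite id_lfunE.
Qed.

Lemma opisomorphic_sym P Q : opisomorphic P Q -> opisomorphic Q P.
Proof.
move=> [f [bf fA fB]].
have kf : lker f == 0%VS by apply/lker0P/bij_inj.
have fK : cancel f (f^-1)%VF by exact: lker0_lfunK.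
have Kf : cancel (f^-1)%VF f by apply/(bij_can_sym bf).
exists (f^-1)%VF; split; first by exists f.
  apply/lfunP => y; rewrite !comp_lfunE /= -{1}[y]Kf.
  by have /lfunP/(_ (f^-1 y)%VF) := fA; rewrite !comp_lfunE => <-; rewrite fK.
apply/lfunP => y; rewrite !comp_lfunE /= -{1}[y]Kf.
by have /lfunP/(_ (f^-1 y)%VF) := fB; rewrite !comp_lfunE => <-; rewrite fK.
Qed.

Lemma mulmx_cV_inj m n (M N : 'M[F]_(m, n)) :
  (forall u : 'cV_n, M *m u = N *m u) -> M = N.
Proof.
move=> h; apply/matrixP => i j; have := h (delta_mx j 0); rewrite -!colE.
by move/matrixP/(_ i 0); rewrite !mxE.
Qed.

Lemma lfun_cV_mx m n (f : 'Hom('cV[F]_m, 'cV[F]_n)) :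
  exists a : 'M_(n, m), forall u, f u = a *m u.
Proof.
exists (\matrix_(i, j) f (delta_mx j 0) i 0) => u.
rewrite {1}[u]matrix_sum_delta linear_sum; apply/matrixP => i j.
rewrite summxE ord1 [RHS]mxE; apply: eq_bigr => k _.
by rewrite big_ord1 linearZ /= !mxE mulrC.
Qed.

Lemma opisomorphic_mx (P Q : mxpair F) :
  opisomorphic (oppair_of_mx P) (oppair_of_mx Q) <-> isomorphic P Q.
Proof.
split=> [iPQ|[a [b [[aA aB] _ [ab ba]]]]]; last first.
  exists (linfun (mulmx a)); split.
  - by exists (mulmx b) => u; rewrite lfunE /= mulmxA ?ab ?ba mul1mx.
  - by apply/lfunP => u; rewrite !comp_lfunE !lfunE /= !mulmxA aA.
  - by apply/lfunP => u; rewrite !comp_lfunE !lfunE /= !mulmxA aB.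
have [f [bf fA fB]] := iPQ; have [a fa] := lfun_cV_mx f.
have kf : lker f == 0%VS by apply/lker0P/bij_inj.
have [b gb] := lfun_cV_mx (f^-1)%VF.
have fK : cancel f (f^-1)%VF by exact: lker0_lfunK.
have Kf : cancel (f^-1)%VF f by apply/(bij_can_sym bf).
have ab : inverse_mx a b.
  by split; apply: mulmx_cV_inj => u; rewrite mul1mx -mulmxA -?gb -fa -?gb ?Kf
    ?fK.
have ha : mxhom P Q a.
  split; apply: mulmx_cV_inj => u.
    by have /lfunP/(_ u) := fA; rewrite !comp_lfunE /= !lfunE /= !fa !mulmxA.
  by have /lfunP/(_ u) := fB; rewrite !comp_lfunE /= !lfunE /= !fa !mulmxA.
by exists a, b; split=> //; exact: mxhom_inv ha ab.
Qed.

End Operators.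

(** * Direct sums of operators and coordinates *)

Definition prod_hom_fun (F : fieldType) (V V' W W' : vectType F)
  (f : 'Hom(V, V')) (g : 'Hom(W, W')) (x : V * W) : V' * W' := (f x.1, g x.2).

Fact prod_hom_fun_is_linear (F : fieldType) (V V' W W' : vectType F)
  (f : 'Hom(V, V')) (g : 'Hom(W, W')) : linear (prod_hom_fun f g).
Proof. by move=> a x y; rewrite /prod_hom_fun /= !linearP. Qed.

HB.instance Definition _ (F : fieldType) (V V' W W' : vectType F)
  (f : 'Hom(V, V')) (g : 'Hom(W, W')) :=
  GRing.isLinear.Build F (V * W)%type (V' * W')%type *:%R (prod_hom_fun f g)
    (prod_hom_fun_is_linear f g).

Definition col_mx_pair (F : fieldType) m n (x : 'cV[F]_m * 'cV[F]_n) :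
  'cV[F]_(m + n) := col_mx x.1 x.2.

Fact col_mx_pair_is_linear (F : fieldType) m n : linear (@col_mx_pair F m n).
Proof. by move=> a x y; rewrite /col_mx_pair /= scale_col_mx add_col_mx. Qed.

HB.instance Definition _ (F : fieldType) m n :=
  GRing.isLinear.Build F ('cV[F]_m * 'cV[F]_n)%type 'cV[F]_(m + n) *:%R
    (@col_mx_pair F m n) (@col_mx_pair_is_linear F m n).

Section OperatorSums.
Import passmx.
Variable F : fieldType.

Lemma opisomorphic_dsum (P P' Q Q' : oppair F) :
  opisomorphic P P' -> opisomorphic Q Q' ->
  opisomorphic (opdsum P Q) (opdsum P' Q').
Proof.
move=> [f [[f' fK Kf] fA fB]] [g [[g' gK Kg] gA gB]].
exists (linfun (prod_hom_fun f g)); split.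
- exists (fun x => (f' x.1, g' x.2)) => -[x y]; rewrite lfunE /= /prod_hom_fun
  /=.
    by rewrite fK gK.
  by rewrite Kf Kg.
- apply/lfunP => /= -[x y]; rewrite !comp_lfunE !lfunE /= /prod_hom_fun
  /prod_fun /=.
  have /lfunP/(_ x) := fA; have /lfunP/(_ y) := gA.
  by rewrite !comp_lfunE => -> ->.
- apply/lfunP => /= -[x y]; rewrite !comp_lfunE !lfunE /= /prod_hom_fun
  /prod_fun /=.
  have /lfunP/(_ x) := fB; have /lfunP/(_ y) := gB.
  by rewrite !comp_lfunE => -> ->.
Qed.

Lemma opisomorphic_dsum_mx (P Q : mxpair F) :
  opisomorphic (opdsum (oppair_of_mx P) (oppair_of_mx Q)) (oppair_of_mx (mxdsum
    P Q)).
Proof.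
exists (linfun (@col_mx_pair F (mxsize P) (mxsize Q))); split.
- exists (fun u : 'cV_(_ + _) => (usubmx u, dsubmx u)) => [[x y]|u];
    rewrite lfunE /= /col_mx_pair /= ?col_mxKu ?col_mxKd ?vsubmxK //.
- apply/lfunP => /= -[x y]; rewrite !comp_lfunE !lfunE /= /prod_fun
  /col_mx_pair /=.
  by rewrite !lfunE /= mul_block_col !mul0mx addr0 add0r.
- apply/lfunP => /= -[x y]; rewrite !comp_lfunE !lfunE /= /prod_fun
  /col_mx_pair /=.
  by rewrite !lfunE /= mul_block_col !mul0mx addr0 add0r.
Qed.

Lemma opsum_mxsum (s : seq (summand F)) :
  opisomorphic (opsum s) (oppair_of_mx (mxsum s)).
Proof.
elim: s => [|x s IH]; first exact: opisomorphic_refl.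
apply: opisomorphic_trans (opisomorphic_dsum_mx _ _).
exact: opisomorphic_dsum (opisomorphic_refl _) IH.
Qed.

Lemma oppair_mx (V : vectType F) (A B : 'End(V)) :
  exists P, opisomorphic (OpPair A B) (oppair_of_mx P).
Proof.
pose e := vbasis {:V}; have be : basis_of {:V} e := vbasisP _.
(* [mxof] acts on row vectors, hence the transpose. *)
pose M C : 'M[F]_(\dim {:V}) := (mxof e e C)^T.
have ME C x : M C *m (rVof e x)^T = (rVof e (C x))^T.
  by rewrite -trmx_mul -rVof_app.
exists (MxPair (M A) (M B)); exists (linfun (trmx \o rVof e)); split.
- exists (fun u => vecof e u^T) => x; rewrite lfunE /=.
    by rewrite trmxK rVofK.
  by rewrite vecofK // trmxK.
- by apply/lfunP => x; rewrite !comp_lfunE !lfunE /= ME.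
- by apply/lfunP => x; rewrite !comp_lfunE !lfunE /= ME.
Qed.

Lemma oppair_annihilating (V : vectType F) (A B : 'End(V)) (P : mxpair F) :
  opisomorphic (OpPair A B) (oppair_of_mx P) ->
  (A \o B)%VF = 0 -> (B \o A)%VF = 0 -> annihilating P.
Proof.
move=> [f [[g fK gK] fA fB]] AB BA.
have fAx x : f (A x) = mxA P *m f x.
  by have /lfunP/(_ x) := fA; rewrite !comp_lfunE lfunE.
have fBx x : f (B x) = mxB P *m f x.
  by have /lfunP/(_ x) := fB; rewrite !comp_lfunE lfunE.
split; apply: mulmx_cV_inj => u; rewrite mul0mx -[u]gK -mulmxA.
  rewrite -fBx -fAx; have /lfunP/(_ (g u)) := AB.
  by rewrite comp_lfunE zero_lfunE => ->; rewrite linear0.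
rewrite -fAx -fBx; have /lfunP/(_ (g u)) := BA.
by rewrite comp_lfunE zero_lfunE => ->; rewrite linear0.
Qed.

Lemma mx_decompositionE (P : mxpair F) s :
  mx_decomposition P s <-> wf_sum s /\ isomorphic P (mxsum s).
Proof.
split=> -[ws i]; split=> //; [exact: similar_isomorphic|exact:
  isomorphic_similar].
Qed.

Lemma op_decompositionE (P : oppair F) (Q : mxpair F) s :
  opisomorphic P (oppair_of_mx Q) ->
  op_decomposition P s <-> wf_sum s /\ isomorphic Q (mxsum s).
Proof.
move=> iPQ; split=> -[ws i]; split=> //.
  apply/opisomorphic_mx; apply: opisomorphic_trans (opsum_mxsum s).
  exact: opisomorphic_trans (opisomorphic_sym iPQ) i.
apply: opisomorphic_trans iPQ _; apply: opisomorphic_trans (opisomorphic_sym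
  (opsum_mxsum s)).
exact/opisomorphic_mx.
Qed.

End OperatorSums.

Theorem theorem7 (F : fieldType) :
  (forall (V : vectType F) (A B : 'End(V)),
     (A \o B)%VF = 0 -> (B \o A)%VF = 0 ->
     (exists s : seq (summand F), op_decomposition (OpPair A B) s) /\
     (forall s s' : seq (summand F), op_decomposition (OpPair A B) s ->
        (op_decomposition (OpPair A B) s' <-> sum_equiv s s')))
  /\
  (forall (n : nat) (A B : 'M[F]_n),
     A *m B = 0 -> B *m A = 0 ->
     (exists s : seq (summand F), mx_decomposition (MxPair A B) s) /\
     (forall s s' : seq (summand F), mx_decomposition (MxPair A B) s ->
        (mx_decomposition (MxPair A B) s' <-> sum_equiv s s'))).
Proof.
split=> [V A B AB BA|n A B AB BA].
  have [P iP] := oppair_mx A B; have aP := oppair_annihilating iP AB BA.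
  split; first by have [s ds] := exists_sum aP; exists s;
    apply/(op_decompositionE _ iP).
  move=> s s' /(op_decompositionE _ iP)[ws i].
  exact: iff_trans (op_decompositionE _ iP) (decomposition_unique _ ws i).
have aP : annihilating (MxPair A B) by [].
split; first by have [s ds] := exists_sum aP; exists s; apply/mx_decompositionE.
move=> s s' /mx_decompositionE[ws i].
exact: iff_trans (mx_decompositionE _ _) (decomposition_unique _ ws i).
Qed.
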